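(* Consider the DORE algorithm (defined in the context) with parameters $\alpha,\beta,\gamma,\eta$, applied to $\min_{\mathbf{x}\in\mathbb{R}^d} f(\mathbf{x})+R(\mathbf{x})$ with $f=\frac1n\sum_{i=1}^n f_i$ and $R:\mathbb{R}^d\to\mathbb{R}$ a closed convex regularizer. Assume that the worker and master compression operators satisfy the compression assumption with nonnegative constants $C_q$ and $C_q^m$ respectively, that the stochastic gradients satisfy the sampling assumption, that each $f_i$ is $L$-Lipschitz differentiable, i.e. $f_i(\mathbf{x})\le f_i(\mathbf{y})+\langle\nabla f_i(\mathbf{y}),\mathbf{x}-\mathbf{y}\rangle+\frac{L}{2}\|\mathbf{x}-\mathbf{y}\|^2$ for all $\mathbf{x},\mathbf{y}\in\mathbb{R}^d$, and that each $f_i$ is $\mu$-strongly convex ($\mu\ge0$), i.e. $f_i(\mathbf{x})\ge f_i(\mathbf{y})+\langle\nabla f_i(\mathbf{y}),\mathbf{x}-\mathbf{y}\rangle+\frac{\mu}{2}\|\mathbf{x}-\mathbf{y}\|^2$ for all $\mathbf{x},\mathbf{y}\in\mathbb{R}^d$. Let $\mathbf{x}^*$ be the solution of the minimization problem. Suppose that $\alpha$ and $\beta$ satisfy $$\frac{1-\sqrt{1-\frac{4C_q(C_q+1)}{nc}}}{2(C_q+1)}\le\alpha\le\frac{1+\sqrt{1-\frac{4C_q(C_q+1)}{nc}}}{2(C_q+1)},\qquad 0<\beta\le\frac{1}{C_q^m+1},$$ with $c\ge\frac{4C_q(C_q+1)}{n}$, and that $\eta$ and $\gamma$ satisfy $$\eta<\min\left(\frac{-C_q^m+\sqrt{(C_q^m)^2+4\big(1-(C_q^m+1)\beta\big)}}{2C_q^m},\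 \frac{4\mu L}{(\mu+L)^2(1+c\alpha)-4\mu L}\right),$$ $$\frac{\eta(\mu+L)}{2(1+\eta)\mu L}\le\gamma\le\frac{2}{(1+c\alpha)(\mu+L)} .$$ Then $$\mathbf{V}^{k+1}\le\rho^k\,\mathbf{V}^1+\frac{(1+\eta)(1+nc\alpha)}{n(1-\rho)}\,\beta\gamma^2\sigma^2,$$ with $$\mathbf{V}^k=\beta\big(1-(C_q^m+1)\beta\big)\mathbb{E}\|\mathbf{q}^{k-1}\|^2+\mathbb{E}\|\hat{\mathbf{x}}^k-\mathbf{x}^*\|^2+\frac{(1+\eta)c\beta\gamma^2}{n}\sum_{i=1}^n\mathbb{E}\|\mathbf{h}_i^k-\nabla f_i(\mathbf{x}^* )\|^2$$ and $$\rho=\max\left(\frac{(\eta^2+\eta)C_q^m}{1-(C_q^m+1)\beta},\ 1+\eta\beta-\frac{2(1+\eta)\beta\gamma\mu L}{\mu+L},\ 1-\alpha\right)<1.$$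
   Context: Setting: $n$ workers and one master; $f_i:\mathbb{R}^d\to\mathbb{R}$ is the local objective of worker $i$. $\|\cdot\|$ is the Euclidean norm, $\mathbb{E}$ is the overall expectation, and $\mathrm{prox}_{\gamma R}(\mathbf{y})=\arg\min_{\mathbf{x}}\{\gamma R(\mathbf{x})+\frac12\|\mathbf{x}-\mathbf{y}\|^2\}$. Compression assumption with constant $C\ge0$: the stochastic operator $Q:\mathbb{R}^d\to\mathbb{R}^d$ is unbiased, $\mathbb{E}\,Q(\mathbf{x})=\mathbf{x}$, and satisfies $\mathbb{E}\|Q(\mathbf{x})-\mathbf{x}\|^2\le C\|\mathbf{x}\|^2$, with $C$ independent of $\mathbf{x}$. All workers use the same compression operator, with constant $C_q$; the master may use a different one, with constant $C_q^m$. Sampling assumption: each worker samples an unbiased estimator of its gradient with bounded variance, i.e. for $i=1,\dots,n$ and all $\mathbf{x}\in\mathbb{R}^d$, the estimator $\mathbf{g}_i$ of $\nabla f_i$ at $\mathbf{x}$ satisfies $\mathbb{E}[\mathbf{g}_i|\mathbf{x}]=\nabla f_i(\mathbf{x})$ and $\mathbb{E}\|\mathbf{g}_i-\nabla f_i(\mathbf{x})\|^2\le\sigma_i^2$. Moreover $\sigma^2=\frac1n\sum_{i=1}^n\sigma_i^2$. DORE algorithm (parameters $\alpha,\beta,\gamma,\eta$): initialize $\mathbf{h}^0=\mathbf{h}_i^0=\mathbf{0}$ and the same $\hat{\mathbf{x}}_i^0=\hat{\mathbf{x}}^0$ for all $i$. Iteration $k$ performs the following. Workers: each worker $i$ samples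 $\mathbf{g}_i^k$ with $\mathbb{E}[\mathbf{g}_i^k|\hat{\mathbf{x}}_i^k]=\nabla f_i(\hat{\mathbf{x}}_i^k)$, sets $\Delta_i^k=\mathbf{g}_i^k-\mathbf{h}_i^k$, compresses $\hat\Delta_i^k=Q(\Delta_i^k)$, sets $\mathbf{h}_i^{k+1}=\mathbf{h}_i^k+\alpha\hat\Delta_i^k$, and sends $\hat\Delta_i^k$ to the master. Master: $\hat\Delta^k=\frac1n\sum_i\hat\Delta_i^k$, $\hat{\mathbf{g}}^k=\mathbf{h}^k+\hat\Delta^k$, $\mathbf{x}^{k+1}=\mathrm{prox}_{\gamma R}(\hat{\mathbf{x}}^k-\gamma\hat{\mathbf{g}}^k)$, $\mathbf{h}^{k+1}=\mathbf{h}^k+\alpha\hat\Delta^k$, $\mathbf{q}^k=\mathbf{x}^{k+1}-\hat{\mathbf{x}}^k+\eta\mathbf{e}^k$, $\hat{\mathbf{q}}^k=Q(\mathbf{q}^k)$, $\mathbf{e}^{k+1}=\mathbf{q}^k-\hat{\mathbf{q}}^k$ (the error being compensated), $\hat{\mathbf{x}}^{k+1}=\hat{\mathbf{x}}^k+\beta\hat{\mathbf{q}}^k$; it broadcasts $\hat{\mathbf{q}}^k$. Each worker then sets $\hat{\mathbf{x}}_i^{k+1}=\hat{\mathbf{x}}_i^k+\beta\hat{\mathbf{q}}^k$, so that $\hat{\mathbf{x}}_i^k=\hat{\mathbf{x}}^k$ for all $i$ and $k$.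
   Formalization: Corrected: the root in the first η bound reads (C_q^m)²+4C_q^m(1−(C_q^m+1)β), with no such bound if C_q^m=0; the lower bound on γ is strict; α>0 and η≥0 are required (otherwise ρ<1 or the inequality can fail); all random draws are independent. *)

(* Defs.v *)
From HB Require Import structures.
From mathcomp Require Import all_boot all_order all_algebra.
From mathcomp Require Import all_classical all_reals all_analysis.

Set Implicit Arguments.
Unset Strict Implicit.
Unset Printing Implicit Defensive.

Import Order.TTheory GRing.Theory Num.Theory.
Import numFieldNormedType.Exports.

Local Open Scope classical_set_scope.
Local Open Scope ring_scope.

Section Euclidean.
Context {R : realType} {d : nat}.
Implicit Types (x y : 'rV[R]_d) (f : 'rV[R]_d -> R).

Definition dotp x y : R := \sum_(j < d) x 0 j * y 0 j.

(* The squared Euclidean norm; the library's `|x| on row vectors is the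
   sup norm. *)
Definition normsq x : R := dotp x x.

Definition grad f x : 'rV[R]_d := \row_j 'D_('e_j) f x.

Definition L_smooth f (L : R) := forall x y,
  f x <= f y + dotp (grad f y) (x - y) + L / 2 * normsq (x - y).

Definition strongly_convex f (mu : R) := forall x y,
  f y + dotp (grad f y) (x - y) + mu / 2 * normsq (x - y) <= f x.

Definition closed_function f :=
  closed [set z : 'rV[R]_d * R | f z.1 <= z.2].

Definition is_minimizer f x := forall y, f x <= f y.

(* For a closed convex f and gamma > 0 the set of minimizers below is a
   singleton, so the default value of xget plays no role. *)
Definition prox (gamma : R) f y : 'rV[R]_d :=
  xget 0 [set p | is_minimizer
                    (fun x => gamma * f x + 2^-1 * normsq (x - y)) p].

End Euclidean.

(* R^d with its Borel sigma-algebra. *)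
Definition borel_rV (R : realType) (d : nat) :=
  g_sigma_algebraType (@open 'rV[R]_d).

(* A stochastic operator on R^d is a map Q : S -> R^d -> R^d together with a
   probability on the seed space S; Q z x is the value at x for the seed z. *)
Section StochasticOperator.
Context {dS : measure_display} {S : measurableType dS} {R : realType}
  {d : nat}.
Implicit Types (P : probability S R) (Q : S -> 'rV[R]_d -> 'rV[R]_d).
Local Open Scope ereal_scope.

Definition jointly_measurable Q :=
  measurable_fun setT
    (fun z : S * borel_rV R d => Q z.1 z.2 : borel_rV R d).

(* The vector equality of means is stated coordinatewise. *)
Definition unbiased_for P Q (m : 'rV[R]_d -> 'rV[R]_d) :=
  forall x j, 'E_P[fun z => Q z x ord0 j] = (m x ord0 j)%:E.

Definition compression_assumption P Q (C : R) :=
  [/\ jointly_measurable Q, unbiased_for P Q id &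
      forall x, 'E_P[fun z => normsq (Q z x - x)] <= (C * normsq x)%:E].

Definition sampling_assumption P Q (f : 'rV[R]_d -> R) (sigma : R) :=
  [/\ jointly_measurable Q, unbiased_for P Q (grad f) &
      forall x,
        'E_P[fun z => normsq (Q z x - grad f x)] <= (sigma ^+ 2)%:E].

End StochasticOperator.

Section Randomness.
Context {dO : measure_display} {Omega : measurableType dO} {R : realType}.
Variable P : probability Omega R.

(* Restricted to measurable sets: a measure carries no information on the
   other ones. *)
Definition has_law {dS : measure_display} {S : measurableType dS}
    (X : Omega -> S) (mu : probability S R) :=
  forall A, measurable A -> P (X @^-1` A) = mu A.

Definition events_of {dS : measure_display} {S : measurableType dS}
    (X : Omega -> S) : set (set Omega) :=
  [set X @^-1` A | A in measurable].

Definition mutually_independent (J : eqType) (G : J -> set (set Omega)) :=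
  forall (s : seq J) (A : J -> set Omega),
    uniq s -> (forall j, j \in s -> G j (A j)) ->
    P (\bigcap_(j in [set` s]) A j) = (\prod_(j <- s) P (A j))%E.

(* The seeds of a run: at iteration k, zg k i is used by worker i to sample a
   gradient, zw k i by worker i to compress, zm k by the master to compress. *)
Definition fresh_seeds {dS dW dM : measure_display}
    {S : measurableType dS} {W : measurableType dW} {M : measurableType dM}
    (n : nat) (zg : nat -> 'I_n -> Omega -> S)
    (zw : nat -> 'I_n -> Omega -> W) (zm : nat -> Omega -> M)
    (nu : nat -> 'I_n -> probability S R)
    (lw : probability W R) (lm : probability M R) :=
  [/\ forall k i, measurable_fun setT (zg k i) /\ has_law (zg k i) (nu k i),
      forall k i, measurable_fun setT (zw k i) /\ has_law (zw k i) lw,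
      forall k, measurable_fun setT (zm k) /\ has_law (zm k) lm &
      mutually_independent
        (fun j : (nat * 'I_n) + (nat * 'I_n) + nat =>
           match j with
           | inl (inl (k, i)) => events_of (zg k i)
           | inl (inr (k, i)) => events_of (zw k i)
           | inr k => events_of (zm k)
           end)].

End Randomness.

Section DORE.
Context {R : realType} {d n : nat}.
Local Notation E := 'rV[R]_d.

Record dore_state := DoreState {
  xhat : E;               (* the master's copy *)
  xhat_w : 'I_n -> E;     (* the workers' copies *)
  h : E;
  h_w : 'I_n -> E;
  err : E }.

Variables (alpha beta gamma eta : R) (reg : E -> R).

Section Step.
(* The realized gradient oracles and compression operators of the iteration. *)
Variables (g : 'I_n -> E -> E) (Qw : 'I_n -> E -> E) (Qm : E -> E).
Variable s : dore_state.

Definition delta_hat (i : 'I_n) : E := Qw i (g i (xhat_w s i) - h_w s i).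

Definition delta_hat_avg : E := n%:R^-1 *: \sum_(i < n) delta_hat i.

Definition g_hat : E := h s + delta_hat_avg.

Definition x_next : E := prox gamma reg (xhat s - gamma *: g_hat).

Definition q_res : E := x_next - xhat s + eta *: err s.

Definition q_hat : E := Qm q_res.

Definition dore_step : dore_state :=
  {| xhat := xhat s + beta *: q_hat;
     xhat_w := fun i => xhat_w s i + beta *: q_hat;
     h := h s + alpha *: delta_hat_avg;
     h_w := fun i => h_w s i + alpha *: delta_hat i;
     err := q_res - q_hat |}.

End Step.

Variables (g : nat -> 'I_n -> E -> E) (Qw : nat -> 'I_n -> E -> E)
  (Qm : nat -> E -> E) (x0 e0 : E).

Fixpoint dore_run (k : nat) : dore_state :=
  if k is k'.+1 then dore_step (g k') (Qw k') (Qm k') (dore_run k')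
  else {| xhat := x0; xhat_w := fun=> x0; h := 0; h_w := fun=> 0;
          err := e0 |}.

Definition dore_q (k : nat) : E := q_res (g k) (Qw k) (dore_run k).

End DORE.

Section Rates.
Context {R : realType}.
Variables (n : nat) (Cq Cqm alpha beta gamma eta c mu L : R).

(* sqrt(1 - 4 Cq (Cq+1) / (n c)), with 0/0 read as 0 when Cq = c = 0. *)
Definition alpha_root : R :=
  Num.sqrt (1 - 4 * Cq * (Cq + 1) / (n%:R * c)).

(* The positive root of (eta^2 + eta) Cqm = 1 - (Cqm+1) beta, which is +oo
   (no constraint) for an uncompressed master, Cqm = 0. *)
Definition eta_bound_master : \bar R :=
  if Cqm == 0 then +oo%E else
  ((- Cqm + Num.sqrt (Cqm ^+ 2 + 4 * Cqm * (1 - (Cqm + 1) * beta)))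
     / (2 * Cqm))%:E.

(* The quotient is taken in \bar R so that it is +oo when mu = L > 0 and
   c * alpha = 0, where the denominator vanishes. *)
Definition eta_bound_step : \bar R :=
  ((4 * mu * L)%:E
     / ((mu + L) ^+ 2 * (1 + c * alpha) - 4 * mu * L)%:E)%E.

(* The first entry is 0/0, read as 0, when Cqm = 0 and beta = 1. *)
Definition dore_rho : R :=
  Num.max ((eta ^+ 2 + eta) * Cqm / (1 - (Cqm + 1) * beta))
    (Num.max (1 + eta * beta
                - 2 * (1 + eta) * beta * gamma * mu * L / (mu + L))
             (1 - alpha)).

End Rates.

Section Lyapunov.
Context {dO : measure_display} {Omega : measurableType dO} {R : realType}
  {d n : nat}.
Variables (P : probability Omega R) (Cqm beta gamma eta c : R).
Variables (f : 'I_n -> 'rV[R]_d -> R) (xstar : 'rV[R]_d).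
Variables (st : nat -> Omega -> @dore_state R d n)
  (q : nat -> Omega -> 'rV[R]_d).
Local Open Scope ereal_scope.

(* Meaningful for k >= 1. *)
Definition lyapunov (k : nat) : \bar R :=
  (beta * (1 - (Cqm + 1) * beta))%:E * 'E_P[fun w => normsq (q k.-1 w)]
  + 'E_P[fun w => normsq (xhat (st k w) - xstar)]
  + ((1 + eta) * c * beta * gamma ^+ 2 / n%:R)%:E
    * \sum_(i < n)
        'E_P[fun w => normsq (h_w (st k w) i - grad (f i) xstar)].

End Lyapunov.

(* Main.v *)
(* Each draw of an iteration is independent of the sigma-algebra of all the other
   draws (Dynkin's pi-lambda theorem), so by Tonelli the master's draw, then each
   worker's compression and gradient draws, can be integrated out one at a time.
   Replacing the message of worker i by its conditional mean costs a multiple of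
   |Delta_i|^2; together with the one produced by the memory h_i, its coefficient
   has the sign of Cq + n c alpha ((Cq + 1) alpha - 1), which is <= 0 when
   alpha lies in the prescribed range.  What is left is a deterministic proximal
   gradient step: nonexpansiveness of the prox, Young's inequality for the
   compensated error and coercivity of the gradients give
   V(k+1) <= rho V(k) + const.
   All second moments are integrals of nonnegative functions with values in
   [0, +oo], so no integrability of the iterates has to be proved beforehand. *)
Require Import Defs.
From HB Require Import structures.
From mathcomp Require Import all_boot all_order all_algebra.
From mathcomp Require Import all_classical all_reals all_analysis.
From mathcomp Require Import measurable_realfun.
From mathcomp Require Import ring lra.
Import Order.TTheory GRing.Theory Num.Theory.
Import numFieldNormedType.Exports.
Local Open Scope classical_set_scope.
Local Open Scope ring_scope.

Set Implicit Arguments.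
Unset Strict Implicit.
Unset Printing Implicit Defensive.

(** No conditional expectation is ever formed. [others G j] is [Omega] itself with the smaller
    sigma-algebra of all draws but j, and measurability on it encodes that a quantity does not see
    draw j. The order of integration is reversed time: the master's draw comes last in its
    iteration, and a compression acts on a gradient already drawn. The workers are treated by a
    hybrid argument on the potentials [Pot p]: at each stage a single random message meets a frozen
    remainder, and its centred part is orthogonal to that remainder. The three entries of [dore_rho]
    answer the three terms of V: the first lets the term in q pay for the compression error carried
    into the next iteration, the second is the contraction of the proximal gradient step, the third
    that of the memories. The bound starts from V(1) because the initial error [e0] is arbitrary,
    whereas every later error comes from a compression. Lipschitz bounds on prox and gradients also
    serve to make the iterates measurable. *)

Ltac row_ring := apply/rowP => ?; rewrite ?mxE; ring.

Lemma cvg_sum_seq {R : realType} {T I : Type} {F : set_system T} {FF : Filter F}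
  (s : seq I) (f : I -> T -> R) (l : I -> R) :
  (forall i, f i t @[t --> F] --> l i) ->
  \sum_(i <- s) f i t @[t --> F] --> \sum_(i <- s) l i.
Proof.
move=> fl; elim: s => [|i s IH].
  have -> : (fun t => \sum_(j <- [::]) f j t) = fun=> 0.
    by apply/funext => t; rewrite big_nil.
  by rewrite big_nil; exact: cvg_cst.
have -> : (fun t => \sum_(j <- i :: s) f j t)
    = fun t => f i t + \sum_(j <- s) f j t.
  by apply/funext => t; rewrite big_cons.
by rewrite big_cons; apply: cvgD.
Qed.

(** * Euclidean inner product and squared norm *)

Section DotProduct.
Context {R : realType} {d : nat}.
Implicit Types (x y z : 'rV[R]_d) (a t : R).

Lemma dotpC x y : dotp x y = dotp y x.
Proof. by apply: eq_bigr => j _; rewrite mulrC. Qed.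

Lemma dotpDl x y z : dotp (x + y) z = dotp x z + dotp y z.
Proof. by rewrite /dotp -big_split; apply: eq_bigr => j _; rewrite mxE mulrDl. Qed.

Lemma dotpZl a x y : dotp (a *: x) y = a * dotp x y.
Proof. by rewrite /dotp mulr_sumr; apply: eq_bigr => j _; rewrite mxE mulrA. Qed.

Lemma dotpNl x y : dotp (- x) y = - dotp x y.
Proof. by rewrite -scaleN1r dotpZl mulN1r. Qed.

Lemma dotpDr x y z : dotp z (x + y) = dotp z x + dotp z y.
Proof. by rewrite !(dotpC z) dotpDl. Qed.

Lemma dotpZr a x y : dotp y (a *: x) = a * dotp y x.
Proof. by rewrite !(dotpC y) dotpZl. Qed.

Lemma dotpNr x y : dotp y (- x) = - dotp y x.
Proof. by rewrite !(dotpC y) dotpNl. Qed.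

Lemma dotp0l x : dotp 0 x = 0.
Proof. by rewrite -(scale0r 0) dotpZl mul0r. Qed.

Lemma dotp_suml (I : Type) (r : seq I) (F : I -> 'rV[R]_d) x :
  dotp (\sum_(i <- r) F i) x = \sum_(i <- r) dotp (F i) x.
Proof.
by elim/big_rec2: _ => [|i y1 y2 _ <-]; rewrite ?dotp0l ?dotpDl.
Qed.

Definition dotpE := (dotpDl, dotpDr, dotpZl, dotpZr, dotpNl, dotpNr).

Lemma normsq_ge0 x : 0 <= normsq x.
Proof. by apply: sumr_ge0 => j _; rewrite -expr2 sqr_ge0. Qed.

Lemma normsq_eq0 x : normsq x = 0 -> x = 0.
Proof.
move=> /eqP; rewrite psumr_eq0 => [/allP h|j _]; last by rewrite -expr2 sqr_ge0.
apply/rowP => j; rewrite mxE.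
by have := h j; rewrite mem_index_enum mulf_eq0 orbb => /(_ isT)/eqP.
Qed.

Lemma normsq0 : normsq (0 : 'rV[R]_d) = 0.
Proof. exact: dotp0l. Qed.

Lemma normsqD x y : normsq (x + y) = normsq x + 2 * dotp x y + normsq y.
Proof. by rewrite /normsq !dotpE (dotpC y); ring. Qed.

Lemma normsqZ a x : normsq (a *: x) = a ^+ 2 * normsq x.
Proof. by rewrite /normsq !dotpE; ring. Qed.

Lemma normsqN x : normsq (- x) = normsq x.
Proof. by rewrite /normsq !dotpE opprK. Qed.

Lemma normsqB x y : normsq (x - y) = normsq x - 2 * dotp x y + normsq y.
Proof. by rewrite normsqD normsqN dotpNr; ring. Qed.

Lemma normsq_conv t x y :
  normsq ((1 - t) *: x + t *: y)
  = (1 - t) * normsq x + t * normsq y - t * (1 - t) * normsq (y - x).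
Proof. by rewrite /normsq !dotpE (dotpC y x); ring. Qed.

(** The gap is exactly [t * normsq (x - y)]. With [t] equal to [eta] this splits off the compensated
    error, whose weight [eta ^+ 2 + eta] reappears in [dore_rho]. *)
Lemma normsq_young t x y : 0 <= t ->
  normsq (x + t *: y) <= (1 + t) * normsq x + (t ^+ 2 + t) * normsq y.
Proof.
move=> t0; rewrite -subr_ge0.
have -> : (1 + t) * normsq x + (t ^+ 2 + t) * normsq y - normsq (x + t *: y)
  = t * normsq (x - y) by rewrite /normsq !dotpE (dotpC y x); ring.
by rewrite mulr_ge0 ?normsq_ge0.
Qed.

(** A substitute for Cauchy-Schwarz, from the expansion of |x - y|^2; it turns monotonicity
    inequalities into Lipschitz bounds. *)
Lemma dotp_normsq_le x y : normsq x <= dotp y x -> normsq x <= normsq y.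
Proof.
by move=> h; have := normsq_ge0 (x - y); rewrite normsqB (dotpC x); lra.
Qed.

Lemma coord_sqr_le_normsq x j : x 0 j ^+ 2 <= normsq x.
Proof.
by rewrite /normsq /dotp (bigD1 j)//= expr2 lerDl sumr_ge0// => i _;
  rewrite -expr2 sqr_ge0.
Qed.

(** Jensen's inequality, read off the nonnegativity of the sum of the |x i - m|^2, m being the
    mean. *)
Lemma normsq_sum_le n (x : 'I_n -> 'rV[R]_d) : (0 < n)%N ->
  normsq (n%:R^-1 *: \sum_i x i) <= n%:R^-1 * \sum_i normsq (x i).
Proof.
move=> n0; set m := n%:R^-1 *: _.
have nn0 : n%:R != 0 :> R by rewrite pnatr_eq0 -lt0n.
have : 0 <= \sum_i normsq (x i - m) by apply: sumr_ge0 => i _; exact: normsq_ge0.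
have -> : \sum_i normsq (x i - m) = \sum_i normsq (x i) - n%:R * normsq m.
  under eq_bigr do rewrite normsqB.
  rewrite big_split/= sumrB -mulr_sumr -dotp_suml sumr_const card_ord.
  have -> : \sum_i x i = n%:R *: m by rewrite scalerA mulfV// scale1r.
  by rewrite dotpZl -mulr_natl /normsq; ring.
rewrite subr_ge0 => h.
by rewrite -(ler_pM2l (_ : 0 < n%:R)) ?ltr0n// mulrA mulfV// mul1r.
Qed.

Lemma normsq_continuous : continuous (@normsq R d).
Proof.
move=> x; apply: (@cvg_sum_seq _ _ _ (nbhs x) (nbhs_filter x)) => j.
by apply: cvgM; exact: coord_continuous.
Qed.

End DotProduct.

(** * Smooth and strongly convex functions *)

Section SmoothConvex.
Context {R : realType} {d : nat}.
Implicit Types (f : 'rV[R]_d -> R) (x y : 'rV[R]_d).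

(* Co-coercivity of the gradient of f - mu/2 |.|^2, obtained by testing the two
   quadratic bounds at a step t along the difference of its gradients;
   t = 1/(L - mu) is optimal, and any t when L = mu. *)
Lemma grad_coercive f (mu L : R) x y : 0 <= mu ->
  L_smooth f L -> strongly_convex f mu ->
  normsq (grad f x - grad f y) + mu * L * normsq (x - y)
  <= (mu + L) * dotp (grad f x - grad f y) (x - y).
Proof.
move=> mu0 smo sco.
set v := x - y; set D := grad f x - grad f y; pose w := D - mu *: v.
have key t : (2 * t - (L - mu) * t ^+ 2) * normsq w <= dotp w v.
  have h1 := smo (x - t *: w) x.
  have h2 := sco (x - t *: w) y.
  have h3 := smo (y + t *: w) y.
  have h4 := sco (y + t *: w) x.
  have ev1 : x - t *: w - x = - (t *: w) by row_ring.
  have ev2 : x - t *: w - y = v - t *: w by rewrite /v; row_ring.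
  have ev3 : y + t *: w - y = t *: w by row_ring.
  have ev4 : y + t *: w - x = - v + t *: w by rewrite /v; row_ring.
  have eg : grad f x = grad f y + w + mu *: v.
    by rewrite /w /D; row_ring.
  rewrite ev1 eg in h1; rewrite ev2 in h2; rewrite ev3 in h3.
  rewrite ev4 eg in h4.
  clear ev1 ev2 ev3 ev4 eg; clearbody w; clearbody D; clearbody v.
  rewrite /normsq !dotpE ?(dotpC w v) in h1 h2 h3 h4 *.
  lra.
(* The two quadratic bounds enclose the same value, so [L < mu] is possible only for [x = y]. *)
have hv : (L - mu) * normsq v >= 0.
  have := smo x y; have := sco x y; rewrite -/v; lra.
suff : normsq w <= (L - mu) * dotp w v.
  rewrite /w; clear key w; clearbody D; clearbody v.
  by rewrite /normsq !dotpE (dotpC v D); lra.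
have [ML|ML|ML] := ltgtP 0 (L - mu).
- have := key (L - mu)^-1; rewrite -(ler_pM2l ML); apply: le_trans.
  rewrite [leRHS](_ : _ = normsq w)//; field.
  by rewrite gt_eqF.
- have v0 : v = 0.
    apply: normsq_eq0; apply/eqP; rewrite eq_le normsq_ge0 andbT.
    by rewrite -(nmulr_rge0 _ ML).
  have D0 : D = 0 by rewrite /D; move/eqP: v0; rewrite subr_eq0 => /eqP ->; rewrite subrr.
  by rewrite /w D0 v0 scaler0 subrr normsq0 dotp0l mulr0.
(* Now [key] bounds 2 t |w|^2 by <w, v> for every t, so w vanishes: otherwise the t below makes the
   left side equal to <w, v> + 1. *)
- rewrite -ML mul0r; have n0 := normsq_ge0 w; rewrite leNgt; apply/negP => nw.
  have := key ((dotp w v + 1) / (2 * normsq w)); rewrite -ML mul0r subr0.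
  rewrite (_ : 2 * _ * _ = dotp w v + 1); first lra.
  by field; rewrite gt_eqF.
Qed.

(** Coercivity without its term in mu L gives the constant mu + L. Sharpness is irrelevant: the
    lemma serves to make the gradient continuous, hence Borel measurable. *)
Lemma grad_lipschitz f (mu L : R) x y : 0 <= mu -> 0 <= L ->
  L_smooth f L -> strongly_convex f mu ->
  normsq (grad f x - grad f y) <= (mu + L) ^+ 2 * normsq (x - y).
Proof.
move=> mu0 L0 smo sco; rewrite -normsqZ; apply: dotp_normsq_le.
have := grad_coercive x y mu0 smo sco; rewrite dotpZl dotpC.
by have := mulr_ge0 (mulr_ge0 mu0 L0) (normsq_ge0 (x - y)); lra.
Qed.

End SmoothConvex.

(** * The proximal map of a closed convex function *)

Section Prox.
Context {R : realType} {d : nat}.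
Implicit Types (reg phi : 'rV[R]_d -> R) (p x y G : 'rV[R]_d).

Definition convex_ineq reg := forall (t : R) x y, 0 <= t -> t <= 1 ->
  reg ((1 - t) *: x + t *: y) <= (1 - t) * reg x + t * reg y.

Lemma convex_functionP reg :
  convex_function [set: convex_lmodType 'rV[R]_d] reg -> convex_ineq reg.
Proof.
move=> cvx t x y t0 t1.
have t01 : 0 <= 1 - t <= 1 by apply/andP; split; lra.
have onemE : unstable.onem (1 - t) = t by rewrite /unstable.onem; ring.
have := cvx (Itv01 (andP t01).1 (andP t01).2) x y.
rewrite !inE => /(_ I I).
change (reg ((1 - t) *: x + unstable.onem (1 - t) *: y)
  <= (1 - t) * reg x + unstable.onem (1 - t) * reg y -> 
  reg ((1 - t) *: x + t *: y) <= (1 - t) * reg x + t * reg y).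
by rewrite onemE.
Qed.

(* First-order optimality, with the quadratic upper bound in place of the
   differentiability of phi. *)
Lemma minimizer_subgradient reg phi p G K : convex_ineq reg ->
  (forall z, phi z <= phi p + dotp G (z - p) + K * normsq (z - p)) ->
  is_minimizer (fun z => phi z + reg z) p ->
  forall z, reg p - dotp G (z - p) <= reg z.
Proof.
move=> cvx ub pmin z; rewrite leNgt; apply/negP => lt_z.
pose e := reg p - dotp G (z - p) - reg z.
have e0 : 0 < e by rewrite /e; lra.
have N0 := normsq_ge0 (z - p).
(* Minimality of p against the point at parameter t of the segment from p to z, divided by t: the
   deficit [e] would be of order t. *)
have step t : 0 < t -> t <= 1 -> e <= t * (K * normsq (z - p)).
  move=> t0 t1; rewrite -(ler_pM2l t0).
  have ez : (1 - t) *: p + t *: z - p = t *: (z - p) by row_ring.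
  have := pmin ((1 - t) *: p + t *: z).
  have := cvx t p z (ltW t0) t1; have := ub ((1 - t) *: p + t *: z).
  rewrite ez normsqZ dotpZr /e; lra.
(* Adding [e] keeps B positive and at least [e], so that t = e / (2 B) lies in the segment and
   yields e <= e / 2. *)
pose B := `|K * normsq (z - p)| + e.
have B0 : 0 < B by rewrite ltr_wpDl.
have := step (e / (2 * B)).
have : e / (2 * B) * (K * normsq (z - p)) < e.
  apply: (@le_lt_trans _ _ (e / 2)); last lra.
  have -> : e / 2 = e / (2 * B) * B by field; rewrite gt_eqF.
  apply: ler_wpM2l; first by rewrite ltW// divr_gt0// mulr_gt0.
  by apply: (le_trans (ler_norm _)); rewrite lerDl ltW.
have -> : 0 < e / (2 * B) by apply: divr_gt0 => //; lra.
have -> : e / (2 * B) <= 1.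
  rewrite ler_pdivrMr ?mul1r//; last lra.
  have := normr_ge0 (K * normsq (z - p)); rewrite /B; lra.
by move=> /[swap] /(_ isT isT); lra.
Qed.

Section ProxProperties.
Variables (reg : 'rV[R]_d -> R) (gamma : R) (m G : 'rV[R]_d) (r0 : R).
Hypotheses (reg_closed : closed_function reg) (reg_convex : convex_ineq reg)
  (gamma0 : 0 < gamma) (minorant : forall z, r0 + dotp G z <= reg z).

Let obj y x := gamma * reg x + 2^-1 * normsq (x - y).

(** Completing the square in the affine minorant plus the quadratic. In the application the minorant
    is the subgradient inequality of the regularizer at [xstar], so no separation theorem is called
    for. *)
Let obj_lower y : exists l, forall x, l <= obj y x.
Proof.
exists (gamma * (r0 + dotp G y) - 2^-1 * gamma ^+ 2 * normsq G) => x.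
have h := ler_wpM2l (ltW gamma0) (minorant x).
have := normsq_ge0 (x - y + gamma *: G).
rewrite normsqD normsqZ dotpZr (dotpC _ G) /obj.
have e : dotp G x = dotp G y + dotp G (x - y).
  by rewrite -dotpDr; congr dotp; row_ring.
rewrite e in h.
lra.
Qed.

(** The quadratic gains |u - v|^2 / 8 at the midpoint, where the objective is still at least l.
    Hence near-minimizers are close together and minimizing sequences are Cauchy. *)
Let obj_midpoint y l u v e : (forall x, l <= obj y x) ->
  obj y u <= l + e -> obj y v <= l + e -> normsq (u - v) <= 8 * e.
Proof.
move=> lb hu hv.
have t12 : (2^-1 : R) <= 1 by lra.
have t0 : (0 : R) <= 2^-1 by lra.
have hc := reg_convex u v t0 t12.
have := lb ((1 - 2^-1) *: u + 2^-1 *: v).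
rewrite /obj.
have -> : (1 - 2^-1) *: u + 2^-1 *: v - y
  = (1 - 2^-1) *: (u - y) + 2^-1 *: (v - y) by row_ring.
rewrite normsq_conv.
have -> : v - y - (u - y) = - (u - v) by row_ring.
rewrite normsqN.
have := ler_wpM2l (ltW gamma0) hc.
move: hu hv; rewrite /obj; lra.
Qed.

(** Existence by completeness rather than compactness: a minimizing sequence with slack 1/(k+1) is
    Cauchy, and closedness of the epigraph passes its bound to the limit. *)
Lemma prox_minimizer y : is_minimizer (obj y) (prox gamma reg y).
Proof.
suff [p pmin] : exists p, is_minimizer (obj y) p.
  exact: (@xgetPex _ 0 [set p | is_minimizer (obj y) p]) (ex_intro _ p pmin).
have [l0 hl0] := obj_lower y.
pose A := [set obj y x | x in setT].
have A0 : A !=set0 by exists (obj y 0); exists 0.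
have Alb : has_lbound A by exists l0 => _ [x _ <-].
pose l := inf A.
have lb x : l <= obj y x by apply: ge_inf => //; exists x.
have [x xP] : {x : nat -> 'rV[R]_d &
    forall k, obj y (x k) <= l + k.+1%:R^-1}.
  apply: (@boolp.choice _ _ (fun k z => obj y z <= l + k.+1%:R^-1)) => k.
  have k0 : 0 < k.+1%:R^-1 :> R by rewrite invr_gt0.
  have [_ [z _ <-] zl] := inf_adherent k0 (conj A0 Alb).
  by exists z; exact: ltW.
have x_cauchy : cauchy (x @ \oo).
  apply: cauchy_exP => e e0.
  have [N _ hN] : \forall N \near \oo, 8 * N.+1%:R^-1 < e ^+ 2.
    have e8 : 0 < e ^+ 2 / 8 by rewrite divr_gt0 ?exprn_gt0.
    have := near_infty_natSinv_lt (PosNum e8).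
    by apply: filterS => N /=; rewrite ltr_pdivlMr// mulrC.
  exists (x N); exists N => // k /= Nk.
  split=> // i j; rewrite /ball/=.
  rewrite ord1 -ltr_sqr ?nnegrE ?normr_ge0 ?(ltW e0)// real_normK ?num_real//.
  have := coord_sqr_le_normsq (x N - x k) j; rewrite !mxE; move/le_lt_trans; apply.
  apply: le_lt_trans (hN N (leqnn N)).
  apply: obj_midpoint (lb) (xP N) _.
  by apply: le_trans (xP k) _; rewrite lerD2l lef_pV2 ?posrE// ler_nat ltnS.
have x_cvg : cvg (x @ \oo) by apply: cauchy_cvg.
pose p := lim (x @ \oo).
exists p => z; apply: le_trans (lb z).
(* Near-minimality of [x k] solved for [reg (x k)]: the points [(x k, s k)] lie in the epigraph, and
   [s] converges because the quadratic is continuous. *)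
pose s k := (l + k.+1%:R^-1 - 2^-1 * normsq (x k - y)) / gamma.
have ns_cvg : normsq (x k - y) @[k --> \oo] --> normsq (p - y).
  have h : (x k - y) @[k --> \oo] --> p - y.
    by apply: cvgB; [exact: x_cvg|exact: cvg_cst].
  exact: (cvg_comp _ _ h (@normsq_continuous R d (p - y))).
have s_cvg : s k @[k --> \oo] --> (l - 2^-1 * normsq (p - y)) / gamma.
  apply: cvgMr_tmp; apply: cvgB; last exact: cvgMl_tmp.
  rewrite -[X in _ --> X]addr0; apply: cvgD; first exact: cvg_cst.
  exact: cvg_harmonic.
have : [set z : 'rV[R]_d * R | reg z.1 <= z.2] (p, (l - 2^-1 * normsq (p - y)) / gamma).
  apply: (@closed_cvg _ _ \oo _ (fun k => (x k, s k)) _ reg_closed _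
    (p, (l - 2^-1 * normsq (p - y)) / gamma)).
    by apply: nearW => k /=; rewrite ler_pdivlMr// mulrC lerBrDr; exact: xP.
  exact: (cvg_pair x_cvg s_cvg).
by rewrite /= ler_pdivlMr// mulrC lerBrDr.
Qed.

Lemma prox_subgradient y z :
  gamma * reg (prox gamma reg y) + dotp (y - prox gamma reg y) (z - prox gamma reg y)
  <= gamma * reg z.
Proof.
set p := prox gamma reg y.
have cvx' : convex_ineq (fun x => gamma * reg x).
  move=> t u v t0 t1.
  have := ler_wpM2l (ltW gamma0) (reg_convex u v t0 t1); lra.
have := @minimizer_subgradient (fun x => gamma * reg x)
  (fun x => 2^-1 * normsq (x - y)) p (p - y) 2^-1 cvx'.
have ub w : 2^-1 * normsq (w - y) <=
   2^-1 * normsq (p - y) + dotp (p - y) (w - p) + 2^-1 * normsq (w - p).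
  have -> : w - y = (p - y) + (w - p) by row_ring.
  by rewrite normsqD; lra.
have pmin : is_minimizer (fun w => 2^-1 * normsq (w - y) + gamma * reg w) p.
  by move=> w; have := prox_minimizer y w; rewrite /obj -/p; lra.
move=> /(_ ub pmin z).
by rewrite -(opprB y p) dotpNl opprK.
Qed.

(** The hypothesis says that -g is a subgradient of [reg] at xs, so xs is the prox of xs - gamma g;
    this is nonexpansiveness between y and that point, from the sum of the two subgradient
    inequalities. Optimality of [xstar] enters the recursion here. *)
Lemma prox_nonexpansive_subgradient y xs g :
  (forall z, reg xs - dotp g (z - xs) <= reg z) ->
  normsq (prox gamma reg y - xs) <= normsq (y + gamma *: g - xs).
Proof.
move=> sub; set p := prox gamma reg y; apply: dotp_normsq_le.
have h1 := prox_subgradient y xs; rewrite -/p in h1.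
have h2 := ler_wpM2l (ltW gamma0) (sub p).
have -> : y + gamma *: g - xs = (y - p) + (p - xs) + gamma *: g by row_ring.
rewrite (dotpDl _ (_ *: _)) (dotpDl (y - p)) dotpZl.
have e : xs - p = - (p - xs) by row_ring.
rewrite e dotpNr in h1.
rewrite /normsq; lra.
Qed.

Lemma prox_nonexpansive y z :
  normsq (prox gamma reg y - prox gamma reg z) <= normsq (y - z).
Proof.
set q := prox gamma reg z.
(* With this g the point q - gamma g is z. *)
have := @prox_nonexpansive_subgradient y q (gamma^-1 *: (q - z)).
rewrite scalerA mulfV ?gt_eqF// scale1r.
have -> : y + (q - z) - q = y - z by row_ring.
apply=> w.
have := prox_subgradient z w; rewrite -/q -(opprB q z) dotpNl => h.
rewrite -(ler_pM2l gamma0) mulrBr dotpZl (mulrA gamma gamma^-1).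
by rewrite mulfV ?gt_eqF// mul1r.
Qed.

End ProxProperties.

End Prox.

(** * Borel measurability in R^d *)

Section BorelRV.
Context {R : realType} {d : nat} {dT : measure_display} {T : measurableType dT}.
Implicit Types X Y : T -> borel_rV R d.

Lemma measurable_funT_borel_real (f : borel_rV R d -> R) :
  (forall A, open A -> open (f @^-1` A : set 'rV[R]_d)) ->
  measurable_fun setT f.
Proof.
move=> fo; apply: (@measurability _ _ _ _ _ _ _ (RGenOpens.measurableE R)).
move=> _ [_ [a [b ->]] <-]; rewrite setTI.
by apply: sub_sigma_algebra; apply: fo; exact: interval_open.
Qed.

Lemma measurable_rV_coord j :
  measurable_fun setT (fun x : borel_rV R d => (x : 'rV[R]_d) 0 j).
Proof.
apply: measurable_funT_borel_real => A; apply: open_comp => x _.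
exact: coord_continuous.
Qed.

(** The Borel sets of R^d come from the coordinates because every open set is a countable union of
    sup-norm boxes with rational centres and radii 1/(k+1). *)
Lemma measurable_fun_rVP X : measurable_fun setT X <->
  (forall j, measurable_fun setT (fun w => (X w : 'rV[R]_d) 0 j)).
Proof.
split=> [mX j|mX].
  exact: (measurableT_comp (measurable_rV_coord j) mX).
apply: (@measurability _ _ T (borel_rV R d) setT X (@open 'rV[R]_d) erefl) => _ [U Uopen <-].
rewrite setTI.
pose box (p : 'rV[rat]_d * nat) : set 'rV[R]_d :=
  [set x | forall j, `|x 0 j - ratr (p.1 0 j)| < p.2.+1%:R^-1].
have -> : X @^-1` U
    = \bigcup_p (if `[< box p `<=` U >] then X @^-1` box p else set0).
  apply/seteqP; split=> [w /= Uw|w [p _]]; last first.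
    by case: ifPn => // /asboolP; exact.
  have /nbhs_ballP[e /= e0 eU] := open_nbhs_nbhs (conj Uopen Uw).
  (* A radius below e / 2 suffices: a box that contains X w then stays within e of it, whatever its
     centre. *)
  have [k _ kP] : \forall k \near \oo, k.+1%:R^-1 < e / 2 :> R.
    have e2 : 0 < e / 2 by rewrite divr_gt0.
    exact: near_infty_natSinv_lt (PosNum e2).
  have {}kP := kP k (leqnn k).
  have /boolp.choice[q qP] : forall j, exists q : rat,
      `|(X w : 'rV[R]_d) 0 j - ratr q| < k.+1%:R^-1.
    move=> j; have : (X w : 'rV[R]_d) 0 j - k.+1%:R^-1
        < (X w : 'rV[R]_d) 0 j + k.+1%:R^-1.
      by rewrite ltrD2l (@lt_trans _ _ 0) ?oppr_lt0 ?invr_gt0.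
    move=> /rat_in_itvoo[q]; rewrite in_itv/= => /andP[q1 q2].
    by exists q; rewrite distrC ltr_distl q1 q2.
  exists (\row_j q j, k) => //=; rewrite ifT.
    by move=> j /=; rewrite mxE.
  apply/asboolP => x xb; apply: eU; split=> // i j; rewrite ord1 /ball/=.
  have := xb j; have := qP j; move: kP; rewrite /= mxE.
  move: (_.+1%:R^-1) => r re h1 h2.
  rewrite -(subrKA (ratr (q j))); apply: (le_lt_trans (ler_normD _ _)).
  rewrite (distrC (ratr _)); lra.
apply: countable_bigcupT_measurable => // p; case: ifP => // _.
have -> : X @^-1` box p = \bigcap_(j in [set: 'I_d])
    ((fun w => (X w : 'rV[R]_d) 0 j) @^-1`
      [set r | `|r - ratr (p.1 0 j)| < p.2.+1%:R^-1]).
  by apply/seteqP; split => w /= h j; [move=> _|]; apply: h.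
apply: fin_bigcap_measurable => // j _; rewrite -[X in measurable X]setTI.
apply: mX => //; apply: open_measurable.
have -> : [set r : R | `|r - ratr (p.1 0 j)| < p.2.+1%:R^-1]
    = ball (ratr (p.1 0 j) : R) p.2.+1%:R^-1.
  by apply/seteqP; split => r /=; rewrite /ball/= distrC.
by apply: ball_open; rewrite invr_gt0.
Qed.

Lemma measurable_rVD X Y : measurable_fun setT X -> measurable_fun setT Y ->
  measurable_fun setT (fun w => (X w : 'rV[R]_d) + Y w : borel_rV R d).
Proof.
move=> /measurable_fun_rVP mX /measurable_fun_rVP mY; apply/measurable_fun_rVP => j.
by under eq_fun do rewrite mxE; exact: measurable_funD.
Qed.

Lemma measurable_rVZ a X : measurable_fun setT X ->
  measurable_fun setT (fun w => a *: (X w : 'rV[R]_d) : borel_rV R d).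
Proof.
move=> /measurable_fun_rVP mX; apply/measurable_fun_rVP => j.
by under eq_fun do rewrite mxE; apply: measurable_funM.
Qed.

Lemma measurable_rVB X Y : measurable_fun setT X -> measurable_fun setT Y ->
  measurable_fun setT (fun w => (X w : 'rV[R]_d) - Y w : borel_rV R d).
Proof.
move=> mX mY; under eq_fun do rewrite -scaleN1r.
by apply: measurable_rVD => //; exact: measurable_rVZ.
Qed.

Lemma measurable_rV_sum n (X : 'I_n -> T -> borel_rV R d) :
  (forall i, measurable_fun setT (X i)) ->
  measurable_fun setT (fun w => \sum_i (X i w : 'rV[R]_d) : borel_rV R d).
Proof.
move=> mX; apply/measurable_fun_rVP => j.
under eq_fun do rewrite summxE.
by apply: measurable_sum => i; have /measurable_fun_rVP := mX i; exact.
Qed.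

Lemma measurable_normsq X : measurable_fun setT X ->
  measurable_fun setT (fun w => normsq (X w)).
Proof.
move=> /measurable_fun_rVP mX; apply: measurable_sum => j.
exact: measurable_funM.
Qed.

End BorelRV.

Lemma lipschitz_continuous {R : realType} {d : nat} (F : 'rV[R]_d -> 'rV[R]_d) K :
  (forall x y, normsq (F x - F y) <= K * normsq (x - y)) -> continuous F.
Proof.
move=> FK x A /nbhs_ballP[e /= e0 eA].
have Fx := nbhs_filter x.
have cK : K * normsq (x - y) @[y --> x] --> 0.
  have -> : 0 = K * normsq (x - x) by rewrite subrr normsq0 mulr0.
  apply: (@cvgMl_tmp _ _ (nbhs x) Fx).
  have xy : x - y @[y --> x] --> x - x.
    by apply: (@cvgB _ _ _ (nbhs x) Fx); [exact: cvg_cst|exact: cvg_id].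
  exact: (cvg_comp _ _ xy (@normsq_continuous R d (x - x))).
have e2 : 0 < e ^+ 2 by rewrite exprn_gt0.
have := @cvgr_lt _ _ (nbhs x) Fx _ _ cK _ e2.
apply: (@filterS _ (nbhs x) Fx) => y yK; apply: eA; split=> // i j; rewrite ord1 /ball/=.
rewrite -ltr_sqr ?nnegrE ?normr_ge0 ?(ltW e0)// real_normK ?num_real//.
have := coord_sqr_le_normsq (F x - F y) j; rewrite !mxE => /le_lt_trans; apply.
exact: le_lt_trans (FK _ _) yK.
Qed.

Lemma continuous_measurable_rV {R : realType} {d : nat} (F : 'rV[R]_d -> 'rV[R]_d) :
  continuous F -> measurable_fun setT (F : borel_rV R d -> borel_rV R d).
Proof.
move=> cF; apply: (@measurability _ _ (borel_rV R d) (borel_rV R d) setT F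
  (@open 'rV[R]_d) erefl) => _ [U Uopen <-].
by rewrite setTI; apply: sub_sigma_algebra; apply: open_comp => // x _; exact: cF.
Qed.

(** * Integrating out one independent seed *)

Section IndependentTonelli.
Context {dO d1 d2 : measure_display} {Omega : measurableType dO}
  {T1 : measurableType d1} {T2 : measurableType d2} {R : realType}.
Variables (P : probability Omega R) (nu : probability T2 R).
Variables (X : {mfun Omega >-> T1}) (Z : Omega -> T2).
Hypotheses (mZ : measurable_fun setT Z)
  (XZ : forall A B, measurable A -> measurable B ->
     P ((X @^-1` A) `&` (Z @^-1` B)) = (P (X @^-1` A) * nu B)%E).
Local Open Scope ereal_scope.

(** The rectangle identity [XZ] determines the joint law of X and Z as a product measure; Tonelli
    applies to it, and the outer integral is pulled back along X. *)
Lemma independent_tonelli (F : T1 * T2 -> \bar R) :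
  measurable_fun setT F -> (forall p, 0 <= F p) ->
  \int[P]_w F (X w, Z w) = \int[P]_w \int[nu]_z F (X w, z).
Proof.
move=> mF F0.
pose XZw w := (X w, Z w).
have mXZ : measurable_fun setT XZw by apply: measurable_fun_pair.
transitivity (\int[pushforward P XZw]_p F p).
  by rewrite ge0_integral_pushforward//= => p _; exact: F0.
transitivity (\int[distribution P X \x nu]_p F p).
  apply: eq_measure_integral => A mA _.
  rewrite -[LHS]/((pushforward P XZw : {measure set _ -> \bar R}) A).
  by apply/esym; apply: product_measure_unique.
rewrite fubini_tonelli1// ge0_integral_distribution//.
  exact: measurable_fun_fubini_tonelli_F.
by move=> x; apply: integral_ge0 => y _; exact: F0.
Qed.

End IndependentTonelli.

(** * Independence of one draw from all the others *)

Section OtherSeeds.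
Context {dO : measure_display} {Omega : measurableType dO} {R : realType}.
Variables (P : probability Omega R) (J : choiceType) (G : J -> set (set Omega)).

(* A pi-system generating the sigma-algebra of the seeds other than j. *)
Definition other_events (j : J) : set (set Omega) :=
  [set B | exists (s : seq J) (A : J -> set Omega),
     [/\ uniq s, j \notin s, forall i, i \in s -> G i (A i)
       & B = \bigcap_(i in [set` s]) A i]].

(** The carrier remains [Omega], so a map on [Omega] need not be factored through the other seeds to
    be declared a function of them: measurability from this type says it. *)
Definition others (j : J) := g_sigma_algebraType (other_events j).

Hypothesis GT : forall i, G i setT.
Hypothesis GI : forall i, setI_closed (G i).
Hypothesis Gm : forall i, G i `<=` measurable.

Lemma other_events_setT j : other_events j setT.
Proof. by exists [::], (fun=> setT); split => //; rewrite bigcap_seq big_nil. Qed.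

Lemma sub_other_events i j A : i != j -> G i A -> other_events j A.
Proof.
move=> ij GA; exists [:: i], (fun=> A); split=> //.
- by rewrite inE eq_sym.
- by move=> k; rewrite inE => /eqP ->.
- by rewrite bigcap_seq big_seq1.
Qed.

(** The two finite lists of labels are merged; a label absent from one of them receives [setT]
    there. *)
Lemma other_events_setI j : setI_closed (other_events j).
Proof.
move=> _ _ [s [A [us js GA ->]]] [t [B [ut jt GB ->]]].
pose A' (u : seq J) (A : J -> set Omega) i := if i \in u then A i else setT.
exists (undup (s ++ t)), (fun i => A' s A i `&` A' t B i); split.
- exact: undup_uniq.
- by rewrite mem_undup mem_cat negb_or js.
- move=> i _; apply: GI; rewrite /A'; case: ifPn => // ?; [exact: GA|exact: GB].
- apply/seteqP; split=> [w [wA wB] i /= _|w h].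
    by split; rewrite /A'; case: ifPn => // i_; [exact: wA|exact: wB].
  split=> i /= i_.
    have := h i; rewrite /= mem_undup mem_cat i_ /= => /(_ isT)[].
    by rewrite /A' i_.
  have := h i; rewrite /= mem_undup mem_cat i_ orbT => /(_ isT)[_].
  by rewrite /A' i_.
Qed.

Lemma other_events_measurable j : other_events j `<=` measurable.
Proof.
move=> _ [s [A [us js GA ->]]]; apply: fin_bigcap_measurable => //.
by move=> i /= /GA; exact: Gm.
Qed.

Lemma measurable_others j A : measurable (A : set (others j)) ->
  measurable (A : set Omega).
Proof.
apply: smallest_sub; first exact: sigma_algebra_measurable.
exact: other_events_measurable.
Qed.

Hypothesis indep : mutually_independent P G.

(** For fixed B both sides are finite measures in A, a restriction and a rescaling of P, so they
    need only agree on the pi-system. There independence is applied to the list [j :: s], with B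
    attached to j. *)
Lemma others_independent j (A B : set Omega) :
  measurable (A : set (others j)) -> G j B ->
  P (A `&` B) = (P A * P B)%E.
Proof.
move=> mA GB; have mB := Gm GB.
pose r := NngNum (fine_ge0 (measure_ge0 P B)).
have -> : (P A * P B)%E = mscale r P A.
  by rewrite /mscale/= muleC fineK// fin_num_measure.
rewrite -[LHS]/(mrestr P mB A).
apply: (@g_sigma_algebra_measure_unique _ _ _ (other_events j)
  (@other_events_measurable j) (fun=> setT)).
- by move=> _; exact: other_events_setT.
- by rewrite bigcup_const.
- exact: other_events_setI.
- move=> _ [s [C [us js GC ->]]].
  change (P ((\bigcap_(i in [set` s]) C i) `&` B)
    = ((fine (P B))%:E * P (\bigcap_(i in [set` s]) C i))%E).
  have hs := indep us GC.
  have := @indep (j :: s) (fun i => if i == j then B else C i).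
  rewrite /= js us => /(_ isT); rewrite bigcap_seq !big_cons eqxx -bigcap_seq.
  have -> : \bigcap_(i in [set` s]) (if i == j then B else C i)
      = \bigcap_(i in [set` s]) C i.
    apply: eq_bigcapr => i /= i_s.
    by case: eqP => // ij; move: js; rewrite -ij i_s.
  have -> : (\prod_(i <- s) P (if i == j then B else C i)
      = \prod_(i <- s) P (C i))%E.
    apply: eq_big_seq => i i_s.
    by case: eqP => // ij; move: js; rewrite -ij i_s.
  rewrite -hs setIC fineK ?fin_num_measure//; apply => i.
  by rewrite inE; case: eqP => [-> //|_ /= /GC].
- move=> _; change (P (setT `&` B) < +oo)%E.
  by rewrite setTI (le_lt_trans (probability_le1 _ _)) ?ltry.
- exact: mA.
Qed.

Section Fresh.
Context {d2 : measure_display} {T2 : measurableType d2}.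
Variables (j : J) (Z : Omega -> T2) (nu : probability T2 R).
Hypotheses (mZ : measurable_fun setT Z) (lawZ : has_law P Z nu)
  (ZG : events_of Z `<=` G j).

Let idm : measurable_fun setT (idfun : Omega -> others j).
Proof. by move=> _ A mA; rewrite setTI; exact: (measurable_others mA). Qed.

(** The freezing lemma: with the other draws fixed at w, only the seed z is random, and a bound on
    its mean valid for every w survives integration over w. *)
Lemma fresh_expectation_le (F : Omega -> T2 -> R) (H : Omega -> R) :
  measurable_fun setT (fun p : others j * T2 => F p.1 p.2) ->
  (forall w z, 0 <= F w z) ->
  measurable_fun setT (H : Omega -> R) ->
  (forall w, 'E_nu[F w] <= (H w)%:E)%E ->
  ('E_P[fun w => F w (Z w)] <= 'E_P[H])%E.
Proof.
move=> mF F0 mH FH.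
(* The random variable collecting all the other draws is the identity into the coarser space. *)
pose X : {mfun Omega >-> others j} :=
  HB.pack (idfun : Omega -> others j) (isMeasurableFun.Build _ _ _ _ _ idm).
rewrite unlock.
have mEF : measurable_fun setT (fun p : others j * T2 => (F p.1 p.2)%:E).
  exact/measurable_EFinP.
rewrite (@independent_tonelli _ _ _ _ _ _ _ P nu X Z mZ _
  (fun p => (F p.1 p.2)%:E))//; last first.
- by move=> p; rewrite lee_fin.
- move=> A B mA mB; rewrite -lawZ//.
  by apply: (others_independent mA); apply: ZG; exists B.
apply: ge0_le_integral => //.
- by move=> w _; apply: integral_ge0 => z _; rewrite lee_fin.
- have mI := @measurable_fun_fubini_tonelli_F _ _ _ _ _ nu _ mEF
    (fun p => F0 p.1 p.2).
  exact: (measurableT_comp mI (@measurable_funPT _ _ _ _ X)).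
- exact/measurable_EFinP.
- by move=> w _; have := FH w; rewrite unlock.
Qed.

End Fresh.
End OtherSeeds.

(** * Expectations of nonnegative functions and second moments *)

Section NonnegExpectation.
Context {dT : measure_display} {T : measurableType dT} {R : realType}.
Variable P : probability T R.
Implicit Types X Y : T -> R.

Lemma expectation_ge0_le X Y :
  measurable_fun setT X -> measurable_fun setT Y ->
  (forall w, 0 <= X w) -> (forall w, X w <= Y w) -> ('E_P[X] <= 'E_P[Y])%E.
Proof.
move=> mX mY X0 XY; rewrite unlock; apply: ge0_le_integral => //.
- by move=> w _; rewrite lee_fin.
- exact/measurable_EFinP.
- exact/measurable_EFinP.
- by move=> w _; rewrite lee_fin.
Qed.

Lemma expectation_ge0D X Y :
  measurable_fun setT X -> measurable_fun setT Y ->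
  (forall w, 0 <= X w) -> (forall w, 0 <= Y w) ->
  ('E_P[fun w => (X w + Y w)%R] = 'E_P[X] + 'E_P[Y])%E.
Proof.
move=> mX mY X0 Y0; rewrite unlock -ge0_integralD//.
- by move=> w _; rewrite lee_fin.
- exact/measurable_EFinP.
- by move=> w _; rewrite lee_fin.
- exact/measurable_EFinP.
Qed.

Lemma expectation_ge0Z k X : 0 <= k ->
  measurable_fun setT X -> (forall w, 0 <= X w) ->
  ('E_P[fun w => (k * X w)%R] = k%:E * 'E_P[X])%E.
Proof.
move=> k0 mX X0; rewrite unlock -ge0_integralZl_EFin//.
- by move=> w _; rewrite lee_fin.
- exact/measurable_EFinP.
Qed.

Lemma expectation_ge0_sum n (X : 'I_n -> T -> R) :
  (forall i, measurable_fun setT (X i)) -> (forall i w, 0 <= X i w) ->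
  ('E_P[fun w => (\sum_i X i w)%R] = \sum_i 'E_P[X i])%E.
Proof.
move=> mX X0; rewrite unlock; under eq_integral do rewrite -sumEFin.
rewrite ge0_integral_sum// => [i|i w _]; last by rewrite lee_fin.
exact/measurable_EFinP.
Qed.

End NonnegExpectation.

Section SecondMoment.
Context {dT : measure_display} {T : measurableType dT} {R : realType} {d : nat}.
Variables (nu : probability T R) (Y : T -> borel_rV R d).
Variables (m : 'rV[R]_d) (v : R).
Hypotheses (mY : measurable_fun setT Y)
  (EY : forall j, ('E_nu[fun z => (Y z : 'rV[R]_d) ord0 j] = (m ord0 j)%:E)%E)
  (VY : ('E_nu[fun z => normsq ((Y z : 'rV[R]_d) - m)%R] <= v%:E)%E).

Let Yc z : 'rV[R]_d := (Y z : 'rV[R]_d) - m.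

Let mYc : measurable_fun setT (Yc : T -> borel_rV R d).
Proof. by apply: measurable_rVB. Qed.

Let int_normsq : nu.-integrable setT (fun z => (normsq (Yc z))%:E).
Proof.
apply/integrableP; split; first exact/measurable_EFinP/measurable_normsq.
under eq_integral do rewrite gee0_abs ?lee_fin ?normsq_ge0//.
by apply: le_lt_trans (ltry v); move: VY; rewrite unlock.
Qed.

(** Finite variance gives integrability through |a| <= 1 + a^2, the measure being finite. *)
Let int_coord j : nu.-integrable setT (fun z => (Yc z 0 j)%:E).
Proof.
have mj : measurable_fun setT (fun z => Yc z 0 j) by have /measurable_fun_rVP := mYc.
apply: (@le_integrable _ _ _ nu setT _ _ (fun z => (1 + normsq (Yc z))%:E)) => //.
- exact/measurable_EFinP.
- move=> z _; rewrite lee_fin [leRHS]ger0_norm ?addr_ge0 ?normsq_ge0//.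
  have := coord_sqr_le_normsq (Yc z) j.
  rewrite -(real_normK (num_real (Yc z 0 j))) /=.
  move: (normsq _) `|Yc z 0 j| (normr_ge0 (Yc z 0 j)) => N a a0.
  by have := sqr_ge0 (a - 1); lra.
- under eq_fun do rewrite EFinD.
  by apply: integrableD => //; exact: finite_measure_integrable_cst.
Qed.

Let mean0 j : (\int[nu]_z (Yc z 0 j)%:E = 0)%E.
Proof.
have iY : nu.-integrable setT (fun z => ((Y z : 'rV[R]_d) 0 j)%:E).
  have -> : (fun z => ((Y z : 'rV[R]_d) 0 j)%:E)
      = (fun z => (Yc z 0 j)%:E) \+ (EFin \o cst (m 0 j)).
    by apply/funext => z /=; rewrite -EFinD /Yc !mxE subrK.
  by apply: integrableD => //; exact: finite_measure_integrable_cst.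
have -> : (fun z => (Yc z 0 j)%:E)
    = fun z => (((Y z : 'rV[R]_d) 0 j)%:E - (cst (m 0 j) z)%:E)%E.
  by apply/funext => z /=; rewrite -EFinB /Yc !mxE.
rewrite integralB_EFin//; last exact: finite_measure_integrable_cst.
have := EY j; rewrite unlock => ->.
have := expectation_cst nu (m 0 j); rewrite unlock => ->.
by rewrite subee.
Qed.

(** Bias and variance for two squares at once, since a worker's message enters both the averaged
    step and its memory. Around the mean the integrand is [p] times |Y - m|^2, a linear term of mean
    zero and a constant. Every draw of the algorithm except the bare error estimate is an
    instance. *)
Lemma expectation_quadratics_le (k1 k2 t1 t2 c0 : R) (a1 a2 : 'rV[R]_d) :
  0 <= k1 -> 0 <= k2 ->
  ('E_nu[fun z => (k1 * normsq (a1 + t1 *: (Y z : 'rV[R]_d))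
     + k2 * normsq (a2 + t2 *: (Y z : 'rV[R]_d)) + c0)%R]
   <= (k1 * (normsq (a1 + t1 *: m) + t1 ^+ 2 * v)
       + k2 * (normsq (a2 + t2 *: m) + t2 ^+ 2 * v) + c0)%:E)%E.
Proof.
move=> k10 k20.
pose u := (2 * k1 * t1) *: (a1 + t1 *: m) + (2 * k2 * t2) *: (a2 + t2 *: m).
pose p := k1 * t1 ^+ 2 + k2 * t2 ^+ 2.
pose c1 := k1 * normsq (a1 + t1 *: m) + k2 * normsq (a2 + t2 *: m) + c0.
have p0 : 0 <= p by rewrite addr_ge0// mulr_ge0// sqr_ge0.
have eqF z : k1 * normsq (a1 + t1 *: (Y z : 'rV[R]_d))
     + k2 * normsq (a2 + t2 *: (Y z : 'rV[R]_d)) + c0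
    = p * normsq (Yc z) + (\sum_j (u 0 j * Yc z 0 j) + c1).
  rewrite -[\sum_j _]/(dotp u (Yc z)).
  have eY a t : a + t *: (Y z : 'rV[R]_d) = (a + t *: m) + t *: Yc z.
    by rewrite /Yc; row_ring.
  rewrite !eY /u /c1 /p; move: (Yc z) (a1 + _) (a2 + _) => y b1 b2.
  by rewrite /normsq !dotpE (dotpC y b1) (dotpC y b2); ring.
have iN : nu.-integrable setT (fun z => (p * normsq (Yc z))%:E).
  by under eq_fun do rewrite EFinM; exact: integrableZl.
have iu j : nu.-integrable setT (fun z => (u 0 j * Yc z 0 j)%:E).
  by under eq_fun do rewrite EFinM; exact: integrableZl.
have iD : nu.-integrable setT (fun z => (\sum_j (u 0 j * Yc z 0 j))%:E).
  by under eq_fun do rewrite -sumEFin; exact: integrable_sum.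
have ic : nu.-integrable setT (fun z => (cst c1 z)%:E).
  exact: finite_measure_integrable_cst.
rewrite unlock; under eq_integral do rewrite eqF EFinD EFinD.
rewrite integralD//; last by apply: integrableD.
rewrite integralD//.
have -> : (\int[nu]_z (\sum_j (u 0 j * Yc z 0 j))%:E = 0)%E.
  under eq_integral do rewrite -sumEFin.
  rewrite integral_sum//.
  apply: big1 => j _; under eq_integral do rewrite EFinM.
  by rewrite integralZl// mean0 mule0.
have -> : (\int[nu]_z c1%:E = c1%:E)%E.
  by have := expectation_cst nu c1; rewrite unlock.
rewrite add0e; under eq_integral do rewrite EFinM.
rewrite integralZl//.
have hv : (p%:E * \int[nu]_z (normsq (Yc z))%:E <= p%:E * v%:E)%E.
  by apply: lee_wpmul2l; rewrite ?lee_fin//; move: VY; rewrite unlock.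
apply: (le_trans (leeD2r _ hv)); rewrite -EFinM -EFinD lee_fin /p /c1.
by rewrite le_eqVlt; apply/orP; left; apply/eqP; ring.
Qed.

End SecondMoment.

(** * Step sizes *)

Section StepSizes.
Context {R : realType}.
Variables (n : nat) (Cq Cqm alpha beta gamma eta c mu L : R).
Hypotheses (n_gt0 : (0 < n)%N) (Cq_ge0 : 0 <= Cq) (Cqm_ge0 : 0 <= Cqm).
Hypotheses (c_ge : 4 * Cq * (Cq + 1) / n%:R <= c) (alpha_gt0 : 0 < alpha)
  (alpha_ge : (1 - alpha_root n Cq c) / (2 * (Cq + 1)) <= alpha)
  (alpha_le : alpha <= (1 + alpha_root n Cq c) / (2 * (Cq + 1))).
Hypotheses (mu_ge0 : 0 <= mu) (beta_gt0 : 0 < beta)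
  (beta_le : beta <= 1 / (Cqm + 1)) (eta_ge0 : 0 <= eta)
  (eta_lt : (eta%:E < Order.min (eta_bound_master Cqm beta)
                                (eta_bound_step alpha c mu L))%E)
  (gamma_gt : eta * (mu + L) / (2 * (1 + eta) * mu * L) < gamma)
  (gamma_le : gamma <= 2 / ((1 + c * alpha) * (mu + L))).

Let n0 : 0 < n%:R :> R. Proof. by rewrite ltr0n. Qed.

Let four_Cq_le : 4 * Cq * (Cq + 1) <= n%:R * c.
Proof. by move: c_ge; rewrite ler_pdivrMr// (mulrC n%:R). Qed.

Let Cq_prod_ge0 : 0 <= 4 * Cq * (Cq + 1).
Proof. by apply: mulr_ge0; [rewrite mulr_ge0|rewrite addr_ge0]. Qed.

Lemma c_nonneg : 0 <= c.
Proof. by rewrite -(pmulr_rge0 _ n0) (le_trans Cq_prod_ge0). Qed.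

(** The prescribed range is the interval between the roots of this quadratic in [alpha], that is |2
    (Cq + 1) alpha - 1| <= [alpha_root]. *)
Lemma alpha_quadratic_le0 : Cq + n%:R * c * alpha * ((Cq + 1) * alpha - 1) <= 0.
Proof.
have Cq1 : 0 < 2 * (Cq + 1) by have := Cq_ge0; lra.
(* When c = 0 the lower bound on c forces Cq = 0, and every term vanishes. *)
have [c0|c0] := eqVneq c 0.
  have : Cq = 0.
    apply/eqP; rewrite eq_le Cq_ge0 andbT.
    by move: four_Cq_le; rewrite c0 mulr0; have := sqr_ge0 Cq; lra.
  by move=> ->; rewrite c0 mulr0 !mul0r addr0.
have {}c0 : 0 < c by rewrite lt_def c0 c_nonneg.
have nc0 : 0 < n%:R * c by rewrite mulr_gt0.
pose D := 1 - 4 * Cq * (Cq + 1) / (n%:R * c).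
have D0 : 0 <= D by rewrite subr_ge0 ler_pdivrMr// mul1r.
pose r := alpha_root n Cq c.
have rD : r ^+ 2 = D by rewrite sqr_sqrtr.
have h1 : 1 - r <= 2 * (Cq + 1) * alpha.
  by move: alpha_ge; rewrite ler_pdivrMr// (mulrC alpha).
have h2 : 2 * (Cq + 1) * alpha <= 1 + r.
  by move: alpha_le; rewrite ler_pdivlMr// (mulrC alpha).
have : (2 * (Cq + 1) * alpha - 1) ^+ 2 <= D.
  have a1 : 0 <= 2 * (Cq + 1) * alpha - 1 + r by lra.
  have a2 : 0 <= r - (2 * (Cq + 1) * alpha - 1) by lra.
  by rewrite -rD; have := mulr_ge0 a1 a2; lra.
rewrite /D -(ler_pM2l nc0) [leRHS]mulrBr mulr1
  [n%:R * c * (_ / _)]mulrC divfK ?gt_eqF// => h.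
(* This factor completes the square: the product is n c ((2 (Cq + 1) alpha - 1)^2 - 1) + 4 Cq (Cq +
   1). *)
rewrite -(pmulr_rle0 _ (_ : 0 < 4 * (Cq + 1))); last lra.
move: h; lra.
Qed.

Lemma alpha_le1 : alpha <= 1.
Proof.
have Cq1 : 0 < 2 * (Cq + 1) by have := Cq_ge0; lra.
apply: (le_trans alpha_le); rewrite ler_pdivrMr// mul1r.
have : alpha_root n Cq c <= 1.
  rewrite -[leRHS]sqrtr1; apply: ler_wsqrtr.
  rewrite gerBl mulr_ge0// invr_ge0 mulr_ge0 ?c_nonneg//; exact: ltW.
by have := Cq_ge0; lra.
Qed.

Let eta_master : (eta%:E < eta_bound_master Cqm beta)%E.
Proof. by move: eta_lt; rewrite lt_min => /andP[]. Qed.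

Let eta_step : (eta%:E < eta_bound_step alpha c mu L)%E.
Proof. by move: eta_lt; rewrite lt_min => /andP[]. Qed.

(** If mu L <= 0, the numerator of [eta_bound_step] is nonpositive and its denominator nonnegative,
    so the strict bound would put [eta] below 0. A zero denominator is covered too, its inverse
    being +oo. *)
Lemma mu_L_gt0 : 0 < mu /\ 0 < L.
Proof.
suff muL : 0 < mu * L.
  have m0 : 0 < mu.
    by rewrite lt_def mu_ge0 andbT; apply: contraTneq muL => ->; rewrite mul0r ltxx.
  by split=> //; rewrite -(pmulr_rgt0 _ m0).
rewrite ltNge; apply/negP => muL.
have : (eta_bound_step alpha c mu L <= 0)%E.
  rewrite /eta_bound_step; apply: mule_le0_ge0.
    by rewrite lee_fin -mulrA pmulr_rle0.
  rewrite inve_ge0 lee_fin.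
  have := sqr_ge0 (mu + L).
  have := mulr_ge0 (mulr_ge0 c_nonneg (ltW alpha_gt0)) (sqr_ge0 (mu + L)); lra.
move=> /(lt_le_trans eta_step); rewrite lte_fin.
by have := eta_ge0; lra.
Qed.

Lemma master_slack_ge0 : 0 <= 1 - (Cqm + 1) * beta.
Proof.
have C1 : 0 < Cqm + 1 by have := Cqm_ge0; lra.
by move: beta_le; rewrite ler_pdivlMr// subr_ge0 mulrC.
Qed.

Lemma master_error_lt : Cqm != 0 ->
  (eta ^+ 2 + eta) * Cqm < 1 - (Cqm + 1) * beta.
Proof.
move=> C0; have {}C0 : 0 < Cqm by rewrite lt_def C0 Cqm_ge0.
move: eta_master; rewrite /eta_bound_master gt_eqF// lte_fin ltr_pdivlMr; last lra.
set w := 1 - _; set s := Num.sqrt _ => h.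
have w0 : 0 <= w by exact: master_slack_ge0.
have s2 : s ^+ 2 = Cqm ^+ 2 + 4 * Cqm * w.
  by rewrite sqr_sqrtr// addr_ge0 ?sqr_ge0// !mulr_ge0// ltW.
have p0 : 0 <= Cqm * (2 * eta + 1).
  by apply: mulr_ge0; have := eta_ge0; lra.
(* The product of the two factors is s^2 - Cqm^2 (2 eta + 1)^2 = 4 Cqm (w - Cqm (eta^2 + eta)). *)
have a1 : 0 < s - Cqm * (2 * eta + 1) by lra.
have a2 : 0 < s + Cqm * (2 * eta + 1) by lra.
rewrite -(ltr_pM2l C0).
by have := mulr_gt0 a1 a2; lra.
Qed.

Let rho := dore_rho Cqm alpha beta gamma eta mu L.

Lemma gamma_gt0 : 0 < gamma.
Proof.
have [m0 l0] := mu_L_gt0; apply: le_lt_trans gamma_gt.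
by rewrite mulr_ge0 ?mulr_ge0 ?invr_ge0 ?addr_ge0 ?mulr_ge0// ?addr_ge0// ltW.
Qed.

Lemma gamma_mul_le : gamma * (1 + c * alpha) * (mu + L) <= 2.
Proof.
have [m0 l0] := mu_L_gt0; rewrite -mulrA -ler_pdivlMr//.
apply: mulr_gt0; last exact: addr_gt0.
by rewrite ltr_wpDr// mulr_ge0 ?c_nonneg// ltW.
Qed.

Lemma dore_rho_lt1 : rho < 1.
Proof.
have [m0 l0] := mu_L_gt0.
rewrite /rho /dore_rho !gt_max; apply/and3P; split.
(* For an uncompressed master the numerator is 0, so the entry is 0 even if the slack in the
   denominator vanishes. *)
- have [->|C0] := eqVneq Cqm 0; first by rewrite mulr0 mul0r.
  have := master_error_lt C0 => h.
  rewrite ltr_pdivrMr ?mul1r//; apply: le_lt_trans h.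
  by rewrite mulr_ge0// addr_ge0 ?sqr_ge0.
- have ml : 0 < mu + L by rewrite addr_gt0.
  have e1 : 0 < 1 + eta by have := eta_ge0; lra.
  have : eta < 2 * (1 + eta) * gamma * mu * L / (mu + L).
    rewrite ltr_pdivlMr//; move: gamma_gt; rewrite ltr_pdivrMr ?mulr_gt0//; lra.
  rewrite -(ltr_pM2l beta_gt0) => h.
  rewrite -addrA gtrDl subr_lt0 mulrC; apply: (lt_le_trans h).
  by rewrite le_eqVlt; apply/orP; left; apply/eqP; ring.
- by rewrite gtrBl.
Qed.

Lemma dore_rho_ge_alpha : 1 - alpha <= rho.
Proof. by rewrite /rho /dore_rho !le_max lexx !orbT. Qed.

Lemma dore_rho_ge0 : 0 <= rho.
Proof. by apply: le_trans dore_rho_ge_alpha; rewrite subr_ge0 alpha_le1. Qed.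

Lemma dore_rho_ge_step :
  1 + eta * beta - 2 * (1 + eta) * beta * gamma * mu * L / (mu + L) <= rho.
Proof. by rewrite /rho /dore_rho !le_max lexx !orbT. Qed.

(** The first entry of [rho] cleared of its denominator, a form that survives Cqm = 0 and beta =
    1. *)
Lemma dore_rho_ge_master :
  (eta ^+ 2 + eta) * Cqm <= rho * (1 - (Cqm + 1) * beta).
Proof.
have [->|C0] := eqVneq Cqm 0.
  rewrite mulr0 mulr_ge0 ?dore_rho_ge0//.
  have := master_slack_ge0; have := mulr_ge0 Cqm_ge0 (ltW beta_gt0); lra.
have w0 : 0 < 1 - (Cqm + 1) * beta.
  by apply: le_lt_trans (master_error_lt C0); rewrite mulr_ge0// addr_ge0 ?sqr_ge0.
by rewrite -ler_pdivrMr// /rho /dore_rho le_max lexx.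
Qed.

End StepSizes.

(** * Deterministic estimates of one iteration *)

Section OneStep.
Context {R : realType} {d : nat}.
Implicit Types (x y v a b : 'rV[R]_d).

(** Averaged coercivity frees 2 gamma N / (mu + L), N being the mean of the |D i|^2. It has to
    absorb gamma^2 |m|^2, at most gamma^2 N, and the memories' share ca gamma^2 N: this is the upper
    bound on [gamma]. *)
Lemma gradient_step_le n (D : 'I_n -> 'rV[R]_d) v (gamma ca mu L : R) :
  (0 < n)%N -> 0 < mu -> 0 < L -> 0 < gamma ->
  gamma * (1 + ca) * (mu + L) <= 2 ->
  (forall i, normsq (D i) + mu * L * normsq v <= (mu + L) * dotp (D i) v) ->
  normsq (v - gamma *: (n%:R^-1 *: \sum_i D i))
    + ca * gamma ^+ 2 / n%:R * \sum_i normsq (D i)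
  <= (1 - 2 * gamma * mu * L / (mu + L)) * normsq v.
Proof.
move=> n0 m0 l0 g0 gle coer.
have nn0 : 0 < n%:R :> R by rewrite ltr0n.
have ml0 : 0 < mu + L by rewrite addr_gt0.
set m := n%:R^-1 *: _; pose N := n%:R^-1 * \sum_i normsq (D i).
have N0 : 0 <= N.
  by rewrite mulr_ge0 ?invr_ge0 ?(ltW nn0)// sumr_ge0// => i _; exact: normsq_ge0.
have mN : normsq m <= N by exact: normsq_sum_le.
have avg : N + mu * L * normsq v <= (mu + L) * dotp m v.
  have -> : mu * L * normsq v = n%:R^-1 * \sum_(i < n) mu * L * normsq v.
    by rewrite sumr_const card_ord -(mulr_natl (mu * L * _)) mulKf ?gt_eqF.
  rewrite /m dotpZl dotp_suml mulrCA [(mu + L) * \sum_(_ <- _) _]mulr_sumr /N -mulrDr -big_split/=.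
  by rewrite ler_pM2l ?invr_gt0//; apply: ler_sum => i _.
rewrite normsqB normsqZ dotpZr (dotpC v).
have -> : ca * gamma ^+ 2 / n%:R * \sum_i normsq (D i) = ca * gamma ^+ 2 * N.
  by rewrite /N; ring.
have h1 : gamma * (N + mu * L * normsq v) / (mu + L) <= gamma * dotp m v.
  by rewrite ler_pdivrMr//; have := ler_wpM2l (ltW g0) avg; lra.
have h2 : gamma ^+ 2 * (1 + ca) * N <= 2 * gamma * N / (mu + L).
  rewrite ler_pdivlMr//.
  by have := ler_wpM2r N0 (ler_wpM2l (ltW g0) gle); lra.
have h3 := ler_wpM2l (sqr_ge0 gamma) mN.
have e : gamma * (N + mu * L * normsq v) / (mu + L)
   = gamma * N / (mu + L) + gamma * mu * L / (mu + L) * normsq v by ring.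
have e2 : 2 * gamma * mu * L / (mu + L) = 2 * (gamma * mu * L / (mu + L)) by ring.
have e3 : 2 * gamma * N / (mu + L) = 2 * (gamma * N / (mu + L)) by ring.
rewrite e in h1; rewrite e3 in h2; rewrite e2; lra.
Qed.

End OneStep.

Section CompressedStep.
Context {R : realType} {d : nat} {dT : measure_display} {T : measurableType dT}.
Variables (nu : probability T R) (Q : T -> 'rV[R]_d -> 'rV[R]_d).
Implicit Types (x y q a b : 'rV[R]_d).

Let measurable_seed x : jointly_measurable Q ->
  measurable_fun setT (fun z => Q z x : borel_rV R d).
Proof.
move=> mQ; apply: (measurableT_comp mQ (_ : measurable_fun setT (fun z => (z, x : borel_rV R d)))).
by apply: measurable_fun_pair => //; exact: measurable_cst.
Qed.

(** Origin of the weight of q in V: |v + beta q|^2 is the convex combination of |v|^2 and |v + q|^2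
    minus beta (1 - beta) |q|^2, while compression adds at most beta^2 Cqm |q|^2. The balance is
    -beta (1 - (Cqm + 1) beta) |q|^2. *)
Lemma compressed_move_le Cqm beta x xs q : compression_assumption nu Q Cqm ->
  forall C0 : R,
  ('E_nu[fun z => (beta * (1 - (Cqm + 1) * beta) * normsq q
      + normsq (x + beta *: Q z q - xs) + C0)%R]
   <= ((1 - beta) * normsq (x - xs) + beta * normsq (x - xs + q) + C0)%:E)%E.
Proof.
move=> [mQ uQ vQ] C0.
have := expectation_quadratics_le (measurable_seed q mQ) (uQ q) (vQ q) beta 0
  (beta * (1 - (Cqm + 1) * beta) * normsq q + C0) (x - xs) 0 ler01 (lexx 0).
congr (_ <= _)%E.
  congr expectation.body; apply/funext => z; rewrite mul0r mul1r addr0 addrCA addrA.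
  by congr (_ + normsq _ + _); row_ring.
rewrite mul0r addr0 mul1r; congr EFin.
move: (x - xs) => v; rewrite /normsq !dotpE (dotpC q v); ring.
Qed.

(** The convexity identity for b + alpha D leaves -alpha (1 - alpha) |D|^2, against a variance of
    alpha^2 Cq |D|^2 in the memory and t^2 Cq |D|^2 in the step; [coef] is their weighted sum. *)
Lemma compressed_memory_le Cq (kappa B t alpha : R) a b D :
  0 <= kappa -> 0 <= B ->
  kappa * t ^+ 2 * Cq + B * (alpha * ((Cq + 1) * alpha - 1)) <= 0 ->
  compression_assumption nu Q Cq -> forall C0 : R,
  ('E_nu[fun z => (kappa * normsq (a - t *: Q z D)
      + B * normsq (b + alpha *: Q z D) + C0)%R]
   <= (kappa * normsq (a - t *: D)
       + B * ((1 - alpha) * normsq b + alpha * normsq (b + D)) + C0)%:E)%E.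
Proof.
move=> k0 B0 coef [mQ uQ vQ] C0.
have := expectation_quadratics_le (measurable_seed D mQ) (uQ D) (vQ D) (- t) alpha
  C0 a b k0 B0.
under eq_fun do rewrite scaleNr.
move=> /le_trans; apply; rewrite lee_fin scaleNr lerD2r.
have h := mulr_le0_ge0 coef (normsq_ge0 D).
rewrite -subr_ge0; move: h; rewrite -oppr_ge0; congr (0 <= _).
by rewrite /normsq !dotpE (dotpC D b); ring.
Qed.

Lemma sampled_gradient_le (f : 'rV[R]_d -> R) (sigma kappa B t alpha : R) a b y x :
  0 <= kappa -> 0 <= B -> 0 <= alpha ->
  sampling_assumption nu Q f sigma -> forall C0 : R,
  ('E_nu[fun z => (kappa * normsq (a - t *: (Q z x - y))
      + B * ((1 - alpha) * normsq b + alpha * normsq (b + (Q z x - y))) + C0)%R]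
   <= (kappa * normsq (a - t *: (grad f x - y))
       + (kappa * t ^+ 2 * sigma ^+ 2
          + B * ((1 - alpha) * normsq b
                 + alpha * (normsq (b + (grad f x - y)) + sigma ^+ 2))) + C0)%:E)%E.
Proof.
move=> k0 B0 al0 [mQ uQ vQ] C0.
have := expectation_quadratics_le (measurable_seed x mQ) (uQ x) (vQ x) (- t) 1
  (B * ((1 - alpha) * normsq b) + C0) (a + t *: y) (b - y) k0 (mulr_ge0 B0 al0).
have e1 g : a + t *: y + - t *: g = a - t *: (g - y) by row_ring.
have e2 g : b - y + 1 *: g = b + (g - y) by row_ring.
congr (_ <= _)%E.
  by congr expectation.body; apply/funext => z; rewrite e1 e2; ring.
by rewrite e1 e2; congr EFin; ring.
Qed.

End CompressedStep.

(** * Integrating out one draw of the algorithm *)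

Section MeasurableIntegrands.
Context {R : realType} {d : nat} {dT dS : measure_display}
  {T : measurableType dT} {S : measurableType dS}.

Lemma measurable_joint (Q : S -> 'rV[R]_d -> 'rV[R]_d) (Z : T -> S)
  (X : T -> borel_rV R d) : jointly_measurable Q ->
  measurable_fun setT Z -> measurable_fun setT X ->
  measurable_fun setT (fun w => Q (Z w) (X w) : borel_rV R d).
Proof.
by move=> mQ mZ mX; exact: (measurableT_comp mQ (measurable_fun_pair mZ mX)).
Qed.

Lemma measurable_scaled_normsq k (X : T -> borel_rV R d) :
  measurable_fun setT X -> measurable_fun setT (fun w => k * normsq (X w)).
Proof. by move=> mX; apply: measurable_funM => //; exact: measurable_normsq. Qed.

End MeasurableIntegrands.

Section FreshDraws.
Context {dO : measure_display} {Omega : measurableType dO} {R : realType}.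
Variables (P : probability Omega R) (J : choiceType) (G : J -> set (set Omega)).
Hypotheses (GT : forall i, G i setT) (GI : forall i, setI_closed (G i))
  (Gm : forall i, G i `<=` measurable) (indep : mutually_independent P G).
Context {d : nat} {d2 : measure_display} {T2 : measurableType d2}.
Variables (j : J) (Z : Omega -> T2) (nu : probability T2 R)
  (Q : T2 -> 'rV[R]_d -> 'rV[R]_d).
Hypotheses (mZ : measurable_fun setT Z) (lawZ : has_law P Z nu)
  (ZG : events_of Z `<=` G j).

Lemma measurable_fun_others dU (U : measurableType dU) (h : Omega -> U) :
  measurable_fun setT (h : others G j -> U) -> measurable_fun setT h.
Proof.
by move=> mh _ A mA; apply: (measurable_others (j := j) Gm); exact: mh.
Qed.

Local Notation Om := (others G j).
Variables (a b D : Om -> borel_rV R d) (C : Om -> R).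
Hypotheses (ma : measurable_fun setT a) (mb : measurable_fun setT b)
  (mD : measurable_fun setT D) (mC : measurable_fun setT C)
  (C0 : forall w, 0 <= C w).

Let m1 dU (U : measurableType dU) (h : Om -> U) :
  measurable_fun setT h -> measurable_fun setT (fun p : Om * T2 => h p.1).
Proof. by move=> mh; exact: (measurableT_comp mh measurable_fst). Qed.

Let mQD : jointly_measurable Q ->
  measurable_fun setT (fun p : Om * T2 => Q p.2 (D p.1) : borel_rV R d).
Proof.
by move=> mQ; apply: measurable_joint => //; exact: m1.
Qed.

Lemma integrate_compression Cq (kappa B t alpha : R) :
  0 <= kappa -> 0 <= B ->
  kappa * t ^+ 2 * Cq + B * (alpha * ((Cq + 1) * alpha - 1)) <= 0 ->
  compression_assumption nu Q Cq ->
  ('E_P[fun w => (kappa * normsq ((a w : 'rV[R]_d) - t *: Q (Z w) (D w))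
      + B * normsq ((b w : 'rV[R]_d) + alpha *: Q (Z w) (D w)) + C w)%R]
   <= 'E_P[fun w => (kappa * normsq ((a w : 'rV[R]_d) - t *: (D w : 'rV[R]_d))
       + B * ((1 - alpha) * normsq (b w)
              + alpha * normsq ((b w : 'rV[R]_d) + D w)) + C w)%R])%E.
Proof.
move=> k0 B0 coef compr; have [mQ _ _] := compr.
apply: (@fresh_expectation_le _ _ _ P J G GT GI Gm indep _ _ j Z nu mZ lawZ ZG
  (fun w z => kappa * normsq ((a w : 'rV[R]_d) - t *: Q z (D w))
      + B * normsq ((b w : 'rV[R]_d) + alpha *: Q z (D w)) + C w)).
- apply: measurable_funD; last exact: m1.
  apply: measurable_funD; apply: measurable_scaled_normsq.
    by apply: measurable_rVB; [exact: m1|apply: measurable_rVZ; exact: mQD].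
  by apply: measurable_rVD; [exact: m1|apply: measurable_rVZ; exact: mQD].
- by move=> w z; rewrite !addr_ge0 ?mulr_ge0 ?normsq_ge0.
- apply: measurable_fun_others.
  apply: measurable_funD => //; apply: measurable_funD.
    by apply: measurable_scaled_normsq; apply: measurable_rVB => //; exact: measurable_rVZ.
  apply: measurable_funM => //; apply: measurable_funD;
    apply: measurable_scaled_normsq => //; exact: measurable_rVD.
- by move=> w; exact: (compressed_memory_le _ _ _ k0 B0 coef compr).
Qed.

Lemma integrate_gradient (f : 'rV[R]_d -> R) (sigma kappa B t alpha : R)
  (y : Om -> borel_rV R d) : measurable_fun setT y ->
  measurable_fun setT (grad f : borel_rV R d -> borel_rV R d) ->
  0 <= kappa -> 0 <= B -> 0 <= alpha -> alpha <= 1 ->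
  sampling_assumption nu Q f sigma ->
  ('E_P[fun w => (kappa * normsq ((a w : 'rV[R]_d) - t *: (Q (Z w) (D w) - (y w : 'rV[R]_d)))
      + B * ((1 - alpha) * normsq (b w)
             + alpha * normsq ((b w : 'rV[R]_d) + (Q (Z w) (D w) - (y w : 'rV[R]_d)))) + C w)%R]
   <= 'E_P[fun w => (kappa * normsq ((a w : 'rV[R]_d) - t *: (grad f (D w) - (y w : 'rV[R]_d)))
       + (kappa * t ^+ 2 * sigma ^+ 2
          + B * ((1 - alpha) * normsq (b w)
             + alpha * (normsq ((b w : 'rV[R]_d)
                                + (grad f (D w) - (y w : 'rV[R]_d)))
                        + sigma ^+ 2)))
       + C w)%R])%E.
Proof.
move=> my mf k0 B0 al0 al1 samp; have [mQ _ _] := samp.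
apply: (@fresh_expectation_le _ _ _ P J G GT GI Gm indep _ _ j Z nu mZ lawZ ZG
  (fun w z => kappa * normsq ((a w : 'rV[R]_d) - t *: (Q z (D w) - y w))
      + B * ((1 - alpha) * normsq (b w)
             + alpha * normsq ((b w : 'rV[R]_d) + (Q z (D w) - y w))) + C w)).
- apply: measurable_funD; last exact: m1.
  have mG : measurable_fun setT
      (fun p : Om * T2 => Q p.2 (D p.1) - (y p.1 : 'rV[R]_d) : borel_rV R d).
    by apply: measurable_rVB; [exact: mQD|exact: m1].
  apply: measurable_funD.
    apply: measurable_scaled_normsq.
    by apply: measurable_rVB; [exact: m1|apply: measurable_rVZ].
  apply: measurable_funM => //; apply: measurable_funD; apply: measurable_scaled_normsq.
    exact: m1.
  by apply: measurable_rVD; [exact: m1|].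
- move=> w z; rewrite !addr_ge0 ?mulr_ge0 ?addr_ge0 ?mulr_ge0 ?normsq_ge0//.
  by rewrite subr_ge0.
- apply: measurable_fun_others.
  have mM : measurable_fun setT
      (fun w : Om => grad f (D w) - (y w : 'rV[R]_d) : borel_rV R d).
    by apply: measurable_rVB => //; exact: (measurableT_comp mf).
  apply: measurable_funD => //; apply: measurable_funD.
    by apply: measurable_scaled_normsq; apply: measurable_rVB => //; exact: measurable_rVZ.
  apply: measurable_funD => //; apply: measurable_funM => //.
  apply: measurable_funD; first exact: measurable_scaled_normsq.
  apply: measurable_funM => //; apply: measurable_funD => //.
  by apply: measurable_normsq; apply: measurable_rVD.
- by move=> w; exact: (sampled_gradient_le _ _ _ _ _ k0 B0 al0 samp).
Qed.

Lemma integrate_master Cqm beta xs :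
  0 <= beta -> 0 <= 1 - (Cqm + 1) * beta ->
  compression_assumption nu Q Cqm ->
  ('E_P[fun w => (beta * (1 - (Cqm + 1) * beta) * normsq (D w)
      + normsq ((a w : 'rV[R]_d) + beta *: Q (Z w) (D w) - xs) + C w)%R]
   <= 'E_P[fun w => ((1 - beta) * normsq ((a w : 'rV[R]_d) - xs)
       + beta * normsq ((a w : 'rV[R]_d) - xs + (D w : 'rV[R]_d)) + C w)%R])%E.
Proof.
move=> b0 w0 compr; have [mQ _ _] := compr.
apply: (@fresh_expectation_le _ _ _ P J G GT GI Gm indep _ _ j Z nu mZ lawZ ZG
  (fun w z => beta * (1 - (Cqm + 1) * beta) * normsq (D w)
      + normsq ((a w : 'rV[R]_d) + beta *: Q z (D w) - xs) + C w)).
- apply: measurable_funD; last exact: m1.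
  apply: measurable_funD; first by apply: measurable_scaled_normsq; exact: m1.
  apply: measurable_normsq; apply: measurable_rVB; last exact: measurable_cst.
  by apply: measurable_rVD; [exact: m1|apply: measurable_rVZ; exact: mQD].
- by move=> w z; rewrite !addr_ge0 ?mulr_ge0 ?normsq_ge0.
- apply: measurable_fun_others.
  have max : measurable_fun setT (fun w => (a w : 'rV[R]_d) - xs : borel_rV R d).
    by apply: measurable_rVB => //; exact: measurable_cst.
  apply: measurable_funD => //; apply: measurable_funD;
    apply: measurable_scaled_normsq => //; exact: measurable_rVD.
- by move=> w; exact: (compressed_move_le _ _ _ _ compr).
Qed.

Lemma integrate_error Cqm : 0 <= Cqm -> compression_assumption nu Q Cqm ->
  ('E_P[fun w => normsq ((D w : 'rV[R]_d) - Q (Z w) (D w))%R]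
   <= 'E_P[fun w => (Cqm * normsq (D w))%R])%E.
Proof.
move=> Cqm0 [mQ _ vQ].
apply: (@fresh_expectation_le _ _ _ P J G GT GI Gm indep _ _ j Z nu mZ lawZ ZG
  (fun w z => normsq ((D w : 'rV[R]_d) - Q z (D w)))).
- by apply: measurable_normsq; apply: measurable_rVB; [exact: m1|exact: mQD].
- by move=> w z; exact: normsq_ge0.
- by apply: measurable_fun_others; exact: measurable_scaled_normsq.
- move=> w; have := vQ (D w); congr (_ <= _)%E.
  by congr expectation.body; apply/funext => z; rewrite -normsqN opprB.
Qed.

End FreshDraws.

(** * Measurability of the iterates *)

Section RunMeasurable.
Context {R : realType} {d n : nat} {dT dS dW dM : measure_display}
  {T : measurableType dT} {S : measurableType dS} {W : measurableType dW}
  {M : measurableType dM}.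
Variables (alpha beta gamma eta : R) (reg : 'rV[R]_d -> R).
Variables (g : nat -> 'I_n -> S -> 'rV[R]_d -> 'rV[R]_d)
  (Qw : W -> 'rV[R]_d -> 'rV[R]_d) (Qm : M -> 'rV[R]_d -> 'rV[R]_d).
Variables (zg : nat -> 'I_n -> T -> S) (zw : nat -> 'I_n -> T -> W)
  (zm : nat -> T -> M) (x0 e0 : 'rV[R]_d).
Hypotheses (mg : forall k i, jointly_measurable (g k i))
  (mQw : jointly_measurable Qw) (mQm : jointly_measurable Qm)
  (mprox : measurable_fun setT (prox gamma reg : borel_rV R d -> borel_rV R d)).

Let st k w := dore_run alpha beta gamma eta reg (fun k i => g k i (zg k i w))
  (fun k i => Qw (zw k i w)) (fun k => Qm (zm k w)) x0 e0 k.
Let q k w := dore_q alpha beta gamma eta reg (fun k i => g k i (zg k i w))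
  (fun k i => Qw (zw k i w)) (fun k => Qm (zm k w)) x0 e0 k.

Definition state_measurable k :=
  [/\ measurable_fun setT (fun w => xhat (st k w) : borel_rV R d),
      forall i, measurable_fun setT (fun w => xhat_w (st k w) i : borel_rV R d),
      measurable_fun setT (fun w => h (st k w) : borel_rV R d),
      forall i, measurable_fun setT (fun w => h_w (st k w) i : borel_rV R d) &
      measurable_fun setT (fun w => err (st k w) : borel_rV R d)].

Lemma delta_hat_measurable k i : state_measurable k ->
  measurable_fun setT (zg k i) -> measurable_fun setT (zw k i) ->
  measurable_fun setT (fun w => delta_hat (fun i => g k i (zg k i w))
    (fun i => Qw (zw k i w)) (st k w) i : borel_rV R d).
Proof.
move=> [_ mxw _ mhw _] mzg mzw; apply: measurable_joint => //.
by apply: measurable_rVB => //; exact: measurable_joint.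
Qed.

Lemma dore_q_measurable k : state_measurable k ->
  (forall i, measurable_fun setT (zg k i)) ->
  (forall i, measurable_fun setT (zw k i)) ->
  measurable_fun setT (fun w => q k w : borel_rV R d).
Proof.
move=> sm mzg mzw; have [mx _ mh _ me] := sm.
apply: measurable_rVD; last exact: measurable_rVZ.
apply: measurable_rVB => //.
apply: (measurableT_comp mprox (_ : measurable_fun setT (_ : T -> borel_rV R d))).
apply: measurable_rVB => //; apply: measurable_rVZ.
apply: measurable_rVD => //; apply: measurable_rVZ.
by apply: measurable_rV_sum => i; exact: delta_hat_measurable.
Qed.

(** The measurable structure on T is left open, and only the seeds of iterations before k are
    assumed measurable: the lemma applies both to [Omega] and to [others G j] for a draw j not yet
    used. *)
Lemma dore_run_measurable k :
  (forall l, (l < k)%N -> [/\ forall i, measurable_fun setT (zg l i),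
     forall i, measurable_fun setT (zw l i) & measurable_fun setT (zm l)]) ->
  state_measurable k.
Proof.
elim: k => [_|k IH mz].
  by split => [|i||i|]; exact: measurable_cst.
have sm := IH (fun l lk => mz l (ltnW lk)).
have [mx mxw mh mhw me] := sm; have [mzg mzw mzm] := mz k (ltnSn k).
have mq := dore_q_measurable sm mzg mzw.
have mqh : measurable_fun setT (fun w => Qm (zm k w) (q k w) : borel_rV R d).
  exact: measurable_joint.
split => [|i||i|].
- by apply: measurable_rVD => //; exact: measurable_rVZ.
- by apply: measurable_rVD => //; exact: measurable_rVZ.
- apply: measurable_rVD => //; apply: measurable_rVZ; apply: measurable_rVZ.
  by apply: measurable_rV_sum => i; exact: delta_hat_measurable.
- apply: measurable_rVD => //; apply: measurable_rVZ; exact: delta_hat_measurable.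
- exact: measurable_rVB.
Qed.

End RunMeasurable.

(** * The Lyapunov recursion *)

Lemma dore_run_consensus {R : realType} {d n : nat} (alpha beta gamma eta : R)
  (reg : 'rV[R]_d -> R) g Qw Qm x0 e0 k :
  let s := @dore_run R d n alpha beta gamma eta reg g Qw Qm x0 e0 k in
  (forall i, xhat_w s i = xhat s) /\ h s = n%:R^-1 *: \sum_i h_w s i.
Proof.
elim: k => [|k [IHx IHh]] /=.
  by split=> //; rewrite big1 ?scaler0.
split=> [i|]; first by rewrite IHx.
rewrite IHh big_split/= scalerDr; congr (_ + _).
by rewrite -scaler_sumr !scalerA mulrC.
Qed.

Lemma average_minimizer_subgradient {R : realType} {d n : nat}
  (f : 'I_n -> 'rV[R]_d -> R) (reg : 'rV[R]_d -> R) (L : R) xs :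
  (forall i, L_smooth (f i) L) -> convex_ineq reg ->
  is_minimizer (fun x => n%:R^-1 * \sum_(i < n) f i x + reg x) xs ->
  forall z, reg xs - dotp (n%:R^-1 *: \sum_i grad (f i) xs) (z - xs) <= reg z.
Proof.
move=> smo cvx xsmin.
(* An average of L / 2, left unevaluated so that the smoothness bounds of the [f i] add up term by
   term. *)
pose K := n%:R^-1 * \sum_(i < n) L / 2.
apply: (minimizer_subgradient (K := K) cvx _ xsmin) => z.
rewrite dotpZl dotp_suml /K -mulrA -!mulrDr mulr_suml -!big_split/=.
by rewrite ler_wpM2l ?invr_ge0//; apply: ler_sum => i _; exact: smo.
Qed.

Section SeedFamily.
Context {dO : measure_display} {Omega : measurableType dO} {R : realType}.
Variables (J : choiceType) (G : J -> set (set Omega)).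

Lemma measurable_other_seed {dU} {U : measurableType dU} (i j : J) (Y : Omega -> U) :
  i != j -> events_of Y `<=` G i -> measurable_fun setT (Y : others G j -> U).
Proof.
move=> ij YG _ A mA; rewrite setTI; apply: sub_sigma_algebra.
by apply: (sub_other_events ij); apply: YG; exists A.
Qed.

End SeedFamily.

Section EventsOf.
Context {dO dS : measure_display} {Omega : measurableType dO} {S : measurableType dS}.
Variable X : Omega -> S.

Lemma events_of_setT : events_of X setT.
Proof. by exists setT => //; rewrite preimage_setT. Qed.

Lemma events_of_setI : setI_closed (events_of X).
Proof.
move=> _ _ [A mA <-] [B mB <-]; exists (A `&` B); first exact: measurableI.
by rewrite preimage_setI.
Qed.

Lemma events_of_measurable : measurable_fun setT X -> events_of X `<=` measurable.
Proof. by move=> mX _ [A mA <-]; rewrite -[X in measurable X]setTI; exact: mX. Qed.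

End EventsOf.

Section Recursion.
Context {R : realType} {d n : nat}.
Hypothesis n_gt0 : (0 < n)%N.
Variables (f : 'I_n -> 'rV[R]_d -> R) (reg : 'rV[R]_d -> R) (mu L : R).
Hypotheses (f_smooth : forall i, L_smooth (f i) L)
  (f_sconvex : forall i, strongly_convex (f i) mu)
  (reg_closed : closed_function reg) (reg_convex : convex_ineq reg).
Variable xstar : 'rV[R]_d.
Hypothesis xstar_min : is_minimizer
  (fun x => n%:R^-1 * \sum_(i < n) f i x + reg x) xstar.
Context {dS dW dM : measure_display} {S : measurableType dS}
  {W : measurableType dW} {M : measurableType dM}.
Variables (nu : nat -> 'I_n -> probability S R)
  (g : nat -> 'I_n -> S -> 'rV[R]_d -> 'rV[R]_d) (sigma : 'I_n -> R).
Hypothesis g_sampling : forall k i,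
  sampling_assumption (nu k i) (g k i) (f i) (sigma i).
Variables (lw : probability W R) (Qw : W -> 'rV[R]_d -> 'rV[R]_d) (Cq : R).
Hypotheses (Qw_compr : compression_assumption lw Qw Cq).
Variables (lm : probability M R) (Qm : M -> 'rV[R]_d -> 'rV[R]_d) (Cqm : R).
Hypotheses (Cqm_ge0 : 0 <= Cqm) (Qm_compr : compression_assumption lm Qm Cqm).
Context {dO : measure_display} {Omega : measurableType dO}.
Variables (P : probability Omega R)
  (zg : nat -> 'I_n -> Omega -> S) (zw : nat -> 'I_n -> Omega -> W)
  (zm : nat -> Omega -> M).
Hypothesis seeds : fresh_seeds P zg zw zm nu lw lm.
Variables (alpha beta gamma eta c rho : R).
Hypotheses (mu_gt0 : 0 < mu) (L_gt0 : 0 < L) (c_ge0 : 0 <= c)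
  (alpha_gt0 : 0 < alpha) (alpha_le1 : alpha <= 1)
  (alpha_quad : Cq + n%:R * c * alpha * ((Cq + 1) * alpha - 1) <= 0)
  (beta_gt0 : 0 < beta) (slack_ge0 : 0 <= 1 - (Cqm + 1) * beta)
  (gamma_gt0 : 0 < gamma) (gamma_le : gamma * (1 + c * alpha) * (mu + L) <= 2)
  (eta_ge0 : 0 <= eta)
  (rho_ge0 : 0 <= rho) (rho_alpha : 1 - alpha <= rho)
  (rho_step : 1 + eta * beta
     - 2 * (1 + eta) * beta * gamma * mu * L / (mu + L) <= rho)
  (rho_master : (eta ^+ 2 + eta) * Cqm <= rho * (1 - (Cqm + 1) * beta)).
Variables x0 e0 : 'rV[R]_d.

Local Notation E := 'rV[R]_d.
Local Notation B_E := (borel_rV R d).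

Let st k w := dore_run alpha beta gamma eta reg (fun k i => g k i (zg k i w))
  (fun k i => Qw (zw k i w)) (fun k => Qm (zm k w)) x0 e0 k.
Let q k w := dore_q alpha beta gamma eta reg (fun k i => g k i (zg k i w))
  (fun k i => Qw (zw k i w)) (fun k => Qm (zm k w)) x0 e0 k.

Let J : choiceType := ((nat * 'I_n) + (nat * 'I_n) + nat)%type.
Let G (j : J) : set (set Omega) := match j with
  | inl (inl (k, i)) => events_of (zg k i)
  | inl (inr (k, i)) => events_of (zw k i)
  | inr k => events_of (zm k)
  end.
Let time (j : J) : nat := match j with
  | inl (inl (k, _)) => k
  | inl (inr (k, _)) => k
  | inr k => k
  end.

Let mzg k i : measurable_fun setT (zg k i).
Proof. by case: seeds => h _ _ _; have [] := h k i. Qed.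
Let mzw k i : measurable_fun setT (zw k i).
Proof. by case: seeds => _ h _ _; have [] := h k i. Qed.
Let mzm k : measurable_fun setT (zm k).
Proof. by case: seeds => _ _ h _; have [] := h k. Qed.

Let GT j : G j setT.
Proof. by case: j => [[[k i]|[k i]]|k]; exact: events_of_setT. Qed.
Let GI j : setI_closed (G j).
Proof. by case: j => [[[k i]|[k i]]|k]; exact: events_of_setI. Qed.
Let Gm j : G j `<=` measurable.
Proof. by case: j => [[[k i]|[k i]]|k]; exact: events_of_measurable. Qed.
Let indep : mutually_independent P G.
Proof. by case: seeds. Qed.

Let mg k i : jointly_measurable (g k i). Proof. by case: (g_sampling k i). Qed.
Let mQw : jointly_measurable Qw. Proof. by case: Qw_compr. Qed.
Let mQm : jointly_measurable Qm. Proof. by case: Qm_compr. Qed.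

Let hbar : E := n%:R^-1 *: \sum_i grad (f i) xstar.

Let reg_sub z : reg xstar - dotp hbar (z - xstar) <= reg z.
Proof. exact: average_minimizer_subgradient f_smooth reg_convex xstar_min z. Qed.

Let minorant z : (reg xstar + dotp hbar xstar) + dotp (- hbar) z <= reg z.
Proof. by apply: le_trans (reg_sub z); rewrite !dotpE; lra. Qed.

Let mprox : measurable_fun setT (prox gamma reg : B_E -> B_E).
Proof.
apply: continuous_measurable_rV; apply: (@lipschitz_continuous _ _ _ 1) => x y.
rewrite mul1r; exact: (prox_nonexpansive reg_closed reg_convex gamma_gt0 minorant).
Qed.

Let mgrad i : measurable_fun setT (grad (f i) : B_E -> B_E).
Proof.
apply: continuous_measurable_rV; apply: lipschitz_continuous => x y.
exact: (grad_lipschitz x y (ltW mu_gt0) (ltW L_gt0) (f_smooth i) (f_sconvex i)).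
Qed.

Let zg_other (j : J) k i : (inl (inl (k, i)) : J) != j ->
  measurable_fun setT (zg k i : others G j -> S).
Proof. by move=> ij; apply: (measurable_other_seed ij). Qed.
Let zw_other (j : J) k i : (inl (inr (k, i)) : J) != j ->
  measurable_fun setT (zw k i : others G j -> W).
Proof. by move=> ij; apply: (measurable_other_seed ij). Qed.
Let zm_other (j : J) k : (inr k : J) != j ->
  measurable_fun setT (zm k : others G j -> M).
Proof. by move=> ij; apply: (measurable_other_seed ij). Qed.

(** Causality: the state at iteration k uses only draws of earlier iterations, hence not j. *)
Let st_others (j : J) k : (k <= time j)%N ->
  @state_measurable R d n _ _ _ _ (others G j) S W M alpha beta gamma eta reg
    g Qw Qm zg zw zm x0 e0 k.
Proof.
move=> kj; apply: dore_run_measurable => // l lk.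
have lj : l <> time j by move=> e; move: (leq_trans lk kj); rewrite e ltnn.
split=> [i|i|]; [apply: zg_other|apply: zw_other|apply: zm_other];
  by apply/eqP => e; apply: lj; rewrite -e.
Qed.

Let st_measurable k :
  @state_measurable R d n _ _ _ _ Omega S W M alpha beta gamma eta reg
    g Qw Qm zg zw zm x0 e0 k.
Proof. by apply: dore_run_measurable. Qed.

Let q_measurable k : measurable_fun setT (q k : Omega -> B_E).
Proof. by apply: dore_q_measurable. Qed.

(** [kappa] is the weight of the proximal step after averaging by beta and Young's inequality, [t]
    the coefficient of a single message in that step, [B] the weight of the memories in
    [lyapunov]. *)
Let kappa := beta * (1 + eta).
Let t := gamma / n%:R.
Let B := (1 + eta) * c * beta * gamma ^+ 2 / n%:R.

Let n0 : 0 < n%:R :> R. Proof. by rewrite ltr0n. Qed.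
Let kappa_ge0 : 0 <= kappa. Proof. by rewrite mulr_ge0 ?addr_ge0// ltW. Qed.
Let B_ge0 : 0 <= B.
Proof. by rewrite !mulr_ge0 ?invr_ge0 ?sqr_ge0 ?addr_ge0// ltW. Qed.

(** Since B = n c kappa t^2, the common factor kappa t^2 leaves the quadratic in alpha; this is why
    V weights the memories as it does. *)
Let coef : kappa * t ^+ 2 * Cq + B * (alpha * ((Cq + 1) * alpha - 1)) <= 0.
Proof.
have -> : kappa * t ^+ 2 * Cq + B * (alpha * ((Cq + 1) * alpha - 1))
    = (kappa * t ^+ 2) * (Cq + n%:R * c * alpha * ((Cq + 1) * alpha - 1)).
  by rewrite /kappa /t /B; field; rewrite gt_eqF.
by apply: mulr_ge0_le0 => //; rewrite mulr_ge0 ?sqr_ge0.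
Qed.

(** * One iteration in expectation *)

Section Iteration.
Variable k : nat.

(** [m i] is the mean of the message [y i] over both draws of worker i, and [b i] its memory error;
    in [b i + m i] the memory cancels, leaving a gradient difference. [u] is the prox input relative
    to [xstar - gamma *: hbar], before the messages are added. *)
Let y i w : E := delta_hat (fun i => g k i (zg k i w)) (fun i => Qw (zw k i w))
  (st k w) i.
Let m i w : E := grad (f i) (xhat_w (st k w) i) - h_w (st k w) i.
Let b i w : E := h_w (st k w) i - grad (f i) xstar.
Let u w : E := xhat (st k w) - xstar - gamma *: (h (st k w) - hbar).
Let rest w : R := (1 - beta) * normsq (xhat (st k w) - xstar)
  + beta * (eta ^+ 2 + eta) * normsq (err (st k w)).

Let beta_le1 : beta <= 1.
Proof. by have := mulr_ge0 Cqm_ge0 (ltW beta_gt0); have := slack_ge0; lra. Qed.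

Let rest_ge0 w : 0 <= rest w.
Proof.
apply: addr_ge0; apply: mulr_ge0; rewrite ?normsq_ge0 ?subr_ge0//.
by rewrite mulr_ge0 ?addr_ge0 ?sqr_ge0// ltW.
Qed.

Let cost (p : nat) (i : 'I_n) w : R := if (i < p)%N then B * normsq (b i w + alpha *: y i w) else
  kappa * t ^+ 2 * sigma i ^+ 2
  + B * ((1 - alpha) * normsq (b i w)
         + alpha * (normsq (b i w + m i w) + sigma i ^+ 2)).

(* The potential in which the draws of the first p workers have been revealed
   and those of the other workers replaced by their conditional means. *)
Let Pot (p : nat) w : R :=
  kappa * normsq (u w - t *: \sum_(i < n) (if (i < p)%N then y i w else m i w))
  + \sum_i cost p i w + rest w.

Let cost_ge0 p i w : 0 <= cost p i w.
Proof.
rewrite /cost; case: ifP => _; first by rewrite mulr_ge0 ?normsq_ge0.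
apply: addr_ge0.
  by apply: mulr_ge0; [apply: mulr_ge0|]; rewrite ?sqr_ge0.
apply: mulr_ge0 => //; apply: addr_ge0.
  by rewrite mulr_ge0 ?subr_ge0 ?normsq_ge0.
by apply: mulr_ge0; rewrite ?addr_ge0 ?normsq_ge0 ?sqr_ge0// ltW.
Qed.

Let y_others (j : J) i : (k <= time j)%N ->
  (inl (inl (k, i)) : J) != j -> (inl (inr (k, i)) : J) != j ->
  measurable_fun setT (y i : others G j -> B_E).
Proof.
by move=> kj gj wj; apply: delta_hat_measurable => //;
  [exact: st_others|exact: zg_other|exact: zw_other].
Qed.

Let m_others (j : J) i : (k <= time j)%N ->
  measurable_fun setT (m i : others G j -> B_E).
Proof.
move=> /st_others[_ mx _ mh _]; apply: measurable_rVB => //.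
exact: (measurableT_comp (mgrad i) (mx i)).
Qed.

Let b_others (j : J) i : (k <= time j)%N ->
  measurable_fun setT (b i : others G j -> B_E).
Proof.
move=> /st_others[_ _ _ mh _]; apply: measurable_rVB => //; exact: measurable_cst.
Qed.

Let u_others (j : J) : (k <= time j)%N ->
  measurable_fun setT (u : others G j -> B_E).
Proof.
move=> /st_others[mx _ mh _ _]; apply: measurable_rVB.
  by apply: measurable_rVB => //; exact: measurable_cst.
apply: measurable_rVZ; apply: measurable_rVB => //; exact: measurable_cst.
Qed.

Let rest_others (j : J) : (k <= time j)%N ->
  measurable_fun setT (rest : others G j -> R).
Proof.
move=> /st_others[mx _ _ _ me].
apply: measurable_funD; apply: measurable_scaled_normsq => //.
by apply: measurable_rVB => //; exact: measurable_cst.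
Qed.

Let cost_others (j : J) p i : (k <= time j)%N ->
  (inl (inl (k, i)) : J) != j -> (inl (inr (k, i)) : J) != j ->
  measurable_fun setT (cost p i : others G j -> R).
Proof.
move=> kj gj wj; rewrite /cost; case: (i < p)%N.
  apply: measurable_scaled_normsq; apply: measurable_rVD; first exact: b_others.
  by apply: measurable_rVZ; exact: y_others.
apply: measurable_funD => //; apply: measurable_funM => //; apply: measurable_funD.
  by apply: measurable_scaled_normsq; exact: b_others.
apply: measurable_funM => //; apply: measurable_funD => //.
by apply: measurable_normsq; apply: measurable_rVD; [exact: b_others|exact: m_others].
Qed.

(** Only worker i changes status; all the other terms go into [a] and [C], which see neither of its
    two draws. The intermediate expectation has the compression integrated out and the sampled
    gradient still present. *)
Let potential_step (i : 'I_n) : ('E_P[Pot i.+1] <= 'E_P[Pot i])%E.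
Proof.
pose v (l : 'I_n) w : E := if (l < i)%N then y l w else m l w.
pose a w : E := u w - t *: \sum_l (if l != i then v l w else 0).
pose C w : R := \sum_l (if l != i then cost i l w else 0) + rest w.
have C0 w : 0 <= C w.
  by rewrite addr_ge0// sumr_ge0// => l _; case: ifP.
have neq_g (l : 'I_n) : l != i -> (inl (inl (k, l)) : J) != inl (inl (k, i)).
  by apply: contraNneq => -[->].
have neq_w (l : 'I_n) : l != i -> (inl (inr (k, l)) : J) != inl (inr (k, i)).
  by apply: contraNneq => -[->].
have ma j : (k <= time j)%N ->
    (forall l, l != i -> (inl (inl (k, l)) : J) != j) ->
    (forall l, l != i -> (inl (inr (k, l)) : J) != j) ->
    measurable_fun setT (a : others G j -> B_E).
  move=> kj gj wj; apply: measurable_rVB; first exact: u_others.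
  apply: measurable_rVZ; apply: measurable_rV_sum => l.
  have [li|_] := boolP (l != i); last exact: measurable_cst.
  by rewrite /v; case: (l < i)%N; [apply: y_others; auto|exact: m_others].
have mC j : (k <= time j)%N ->
    (forall l, l != i -> (inl (inl (k, l)) : J) != j) ->
    (forall l, l != i -> (inl (inr (k, l)) : J) != j) ->
    measurable_fun setT (C : others G j -> R).
  move=> kj gj wj; apply: measurable_funD; last exact: rest_others.
  apply: measurable_sum => l; have [li|//] := boolP (l != i).
  by apply: cost_others; auto.
have split_sum (V : zmodType) (F F' : 'I_n -> V) : (forall l, l != i -> F l = F' l) ->
    \sum_l F l = F i + \sum_l (if l != i then F' l else 0).
  by move=> FF'; rewrite (bigD1 i)//= -big_mkcond/=; congr (_ + _); exact: eq_bigr.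
have ltS (l : 'I_n) : l != i -> (l < i.+1)%N = (l < i)%N.
  by move=> li; rewrite ltnS leq_eqVlt (negbTE (_ : val l != val i)).
have eqa z w : u w - t *: (z + \sum_l (if l != i then v l w else 0)) = a w - t *: z.
  by rewrite /a scalerDr opprD addrA addrAC.
have e1 w : Pot i.+1 w = kappa * normsq (a w - t *: y i w)
    + B * normsq (b i w + alpha *: y i w) + C w.
  rewrite /Pot (split_sum _ _ (fun l => v l w)); last by move=> l li; rewrite /v ltS.
  rewrite (split_sum _ _ (fun l => cost i l w)); last by move=> l li; rewrite /cost ltS.
  by rewrite {1}/cost ltnSn /C (eqa (y i w)) !addrA.
have e2 w : Pot i w = kappa * normsq (a w - t *: m i w)
    + (kappa * t ^+ 2 * sigma i ^+ 2
      + B * ((1 - alpha) * normsq (b i w)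
             + alpha * (normsq (b i w + m i w) + sigma i ^+ 2))) + C w.
  rewrite /Pot (split_sum _ _ (fun l => v l w))// (split_sum _ _ (fun l => cost i l w))//.
  by rewrite {1}/cost ltnn /C (eqa (m i w)) !addrA.
have -> : Pot i.+1 = fun w => kappa * normsq (a w - t *: y i w)
    + B * normsq (b i w + alpha *: y i w) + C w by apply/funext.
have -> : Pot i = fun w => kappa * normsq (a w - t *: m i w)
    + (kappa * t ^+ 2 * sigma i ^+ 2
      + B * ((1 - alpha) * normsq (b i w)
             + alpha * (normsq (b i w + m i w) + sigma i ^+ 2))) + C w
  by apply/funext.
pose jw : J := inl (inr (k, i)); pose jg : J := inl (inl (k, i)).
have lawZw : has_law P (zw k i) lw by case: seeds => _ hz _ _; case: (hz k i).
have lawZg : has_law P (zg k i) (nu k i) by case: seeds => hz _ _ _; case: (hz k i).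
have [_ mxw _ mhw _] := @st_others jw k (leqnn k).
have [_ mxg _ mhg _] := @st_others jg k (leqnn k).
apply: (@le_trans _ _ ('E_P[fun w => (kappa * normsq (a w
    - t *: (g k i (zg k i w) (xhat_w (st k w) i) - h_w (st k w) i))
  + B * ((1 - alpha) * normsq (b i w) + alpha * normsq (b i w
    + (g k i (zg k i w) (xhat_w (st k w) i) - h_w (st k w) i))) + C w)%R])%E).
- apply: (@integrate_compression _ _ _ P J G GT GI Gm indep d _ _ jw (zw k i)
    lw Qw (mzw k i) lawZw _ a (b i)
    (fun w => g k i (zg k i w) (xhat_w (st k w) i) - h_w (st k w) i) C) => //.
  + by apply: ma => // l; exact: neq_w.
  + exact: b_others.
  + by apply: measurable_rVB => //; apply: measurable_joint => //; exact: zg_other.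
  + by apply: mC => // l; exact: neq_w.
  + exact: coef.
  + exact: Qw_compr.
- have mag : measurable_fun setT (a : others G jg -> B_E).
    by apply: ma => // l; exact: neq_g.
  have mCg : measurable_fun setT (C : others G jg -> R).
    by apply: mC => // l; exact: neq_g.
  exact: (@integrate_gradient _ _ _ P J G GT GI Gm indep d _ _ jg (zg k i)
    (nu k i) (g k i) (mzg k i) lawZg (fun A h => h) a (b i)
    (fun w => xhat_w (st k w) i) C mag (@b_others jg i (leqnn k)) (mxg i) mCg C0
    (f i) (sigma i) kappa B t alpha (fun w => h_w (st k w) i) (mhg i) (mgrad i)
    kappa_ge0 B_ge0 (ltW alpha_gt0) alpha_le1 (g_sampling k i)).
Qed.

Let potential_le : ('E_P[Pot n] <= 'E_P[Pot 0])%E.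
Proof.
suff : forall p, (p <= n)%N -> ('E_P[Pot p] <= 'E_P[Pot 0])%E by apply.
elim=> [//|p IH] pn; apply: (le_trans _ (IH (ltnW pn))).
exact: (potential_step (Ordinal pn)).
Qed.

Let lyap w : R := beta * (1 - (Cqm + 1) * beta) * normsq (q k w)
  + (normsq (xhat (st k.+1 w) - xstar)
     + B * \sum_i normsq (h_w (st k.+1 w) i - grad (f i) xstar)).

Let noise := (1 + eta) * (1 + n%:R * c * alpha) / n%:R * beta * gamma ^+ 2
  * (n%:R^-1 * \sum_i sigma i ^+ 2).

Let q_others (j : J) : (k <= time j)%N ->
  (forall i, (inl (inl (k, i)) : J) != j) ->
  (forall i, (inl (inr (k, i)) : J) != j) ->
  measurable_fun setT (q k : others G j -> B_E).
Proof.
by move=> kj gj wj; apply: dore_q_measurable => //;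
  [exact: st_others|move=> i; exact: zg_other|move=> i; exact: zw_other].
Qed.

Let jm : J := inr k.

Let lawZm : has_law P (zm k) lm.
Proof. by case: seeds => _ _ hz _; case: (hz k). Qed.

Let memory_sum w : \sum_i normsq (h_w (st k.+1 w) i - grad (f i) xstar)
  = \sum_i normsq (b i w + alpha *: y i w).
Proof. by apply: eq_bigr => i _; rewrite /b addrAC. Qed.

Let master_step : ('E_P[lyap] <= 'E_P[fun w =>
  ((1 - beta) * normsq (xhat (st k w) - xstar)
   + beta * normsq (xhat (st k w) - xstar + q k w)
   + B * \sum_i normsq (b i w + alpha *: y i w))%R])%E.
Proof.
have [mx _ _ _ _] := @st_others jm k (leqnn k).
have mC : measurable_fun setT
    ((fun w => B * \sum_i normsq (b i w + alpha *: y i w)) : others G jm -> R).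
  apply: measurable_funM => //; apply: measurable_sum => i.
  apply: measurable_normsq; apply: measurable_rVD; first exact: b_others.
  by apply: measurable_rVZ; exact: y_others.
have mq : measurable_fun setT (q k : others G jm -> B_E) by exact: q_others.
have -> : lyap = fun w => beta * (1 - (Cqm + 1) * beta) * normsq (q k w)
    + normsq (xhat (st k w) + beta *: Qm (zm k w) (q k w) - xstar)
    + B * \sum_i normsq (b i w + alpha *: y i w).
  by apply/funext => w; rewrite /lyap memory_sum addrA.
apply: (@integrate_master _ _ _ P J G GT GI Gm indep d _ _ jm (zm k) lm Qm
  (mzm k) lawZm (fun A h => h) _ (q k) _ mx mq mC _ Cqm beta xstar
  (ltW beta_gt0) slack_ge0 Qm_compr) => w.
by rewrite mulr_ge0 ?sumr_ge0// => i _; exact: normsq_ge0.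
Qed.

(** Pointwise: Young separates the carried error, which joins [rest], and the prox is compared with
    its fixed point [xstar]. *)
Let master_le_potential w :
  (1 - beta) * normsq (xhat (st k w) - xstar)
   + beta * normsq (xhat (st k w) - xstar + q k w)
   + B * \sum_i normsq (b i w + alpha *: y i w) <= Pot n w.
Proof.
have -> : Pot n w = kappa * normsq (u w - t *: \sum_i y i w)
    + B * (\sum_i normsq (b i w + alpha *: y i w)) + rest w.
  rewrite /Pot.
  have -> : \sum_(i < n) (if (i < n)%N then y i w else m i w) = \sum_i y i w.
    by apply: eq_bigr => i _; rewrite ltn_ord.
  congr (_ + _ + _); rewrite mulr_sumr; apply: eq_bigr => i _.
  by rewrite /cost ltn_ord.
pose xn := prox gamma reg
  (xhat (st k w) - gamma *: (h (st k w) + n%:R^-1 *: \sum_i y i w)).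
have -> : xhat (st k w) - xstar + q k w = (xn - xstar) + eta *: err (st k w).
  by rewrite -[q k w]/(xn - xhat (st k w) + eta *: err (st k w)); row_ring.
have h1 := normsq_young (xn - xstar) (err (st k w)) eta_ge0.
have h2 : normsq (xn - xstar) <= normsq (u w - t *: \sum_i y i w).
  have := prox_nonexpansive_subgradient reg_closed reg_convex gamma_gt0 minorant
    (xhat (st k w) - gamma *: (h (st k w) + n%:R^-1 *: \sum_i y i w)) reg_sub.
  move=> /le_trans; apply; rewrite le_eqVlt; apply/orP; left; apply/eqP.
  by congr normsq; rewrite /u /t; row_ring.
have h3 := ler_wpM2l (ltW beta_gt0) h1.
have h4 := ler_wpM2l kappa_ge0 h2.
rewrite /rest /kappa in h4 *; lra.
Qed.

(** With all messages averaged, [gradient_step_le] applies for ca = c alpha, because B alpha = kappa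
    c alpha gamma^2 / n. The coefficient of |xhat - xstar|^2 becomes 1 - beta + kappa (1 - 2 gamma
    mu L / (mu + L)), the second entry of [dore_rho], and that of the memories 1 - alpha. *)
Let potential0_le w : Pot 0 w <= beta * (eta ^+ 2 + eta) * normsq (err (st k w))
  + rho * (normsq (xhat (st k w) - xstar) + B * \sum_i normsq (b i w)) + noise.
Proof.
have [cx ch] : (forall i, xhat_w (st k w) i = xhat (st k w)) /\
    h (st k w) = n%:R^-1 *: \sum_i h_w (st k w) i.
  exact: dore_run_consensus.
pose D i : E := grad (f i) (xhat (st k w)) - grad (f i) xstar.
have bmD i : b i w + m i w = D i by rewrite /b /m cx /D; row_ring.
have umD : u w - t *: \sum_i m i w
    = (xhat (st k w) - xstar) - gamma *: (n%:R^-1 *: \sum_i D i).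
  rewrite /u ch /hbar /t.
  have -> : \sum_i m i w = \sum_i D i - \sum_i h_w (st k w) i
      + \sum_i grad (f i) xstar.
    rewrite -sumrB -big_split/=; apply: eq_bigr => i _.
    by rewrite /m cx /D; row_ring.
  by row_ring.
have -> : Pot 0 w = kappa * (normsq ((xhat (st k w) - xstar)
      - gamma *: (n%:R^-1 *: \sum_i D i))
      + c * alpha * gamma ^+ 2 / n%:R * \sum_i normsq (D i))
    + (1 - alpha) * (B * \sum_i normsq (b i w)) + noise + rest w.
  rewrite /Pot /= umD.
  have -> : \sum_i cost 0 i w = (kappa * t ^+ 2 + B * alpha) * \sum_i sigma i ^+ 2
      + (1 - alpha) * (B * \sum_i normsq (b i w)) + B * alpha * \sum_i normsq (D i).
    have costE i : cost 0 i w = (kappa * t ^+ 2 + B * alpha) * sigma i ^+ 2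
        + (1 - alpha) * (B * normsq (b i w)) + B * alpha * normsq (D i).
      by rewrite /cost ltn0 bmD; ring.
    by rewrite (eq_bigr _ (fun i _ => costE i)) !big_split/= -!mulr_sumr.
  rewrite /noise /kappa /t /B; field; rewrite gt_eqF//.
have h1 := gradient_step_le n_gt0 mu_gt0 L_gt0 gamma_gt0 gamma_le
  (fun i => grad_coercive (xhat (st k w)) xstar (ltW mu_gt0) (f_smooth i) (f_sconvex i)).
have h2 := ler_wpM2l kappa_ge0 h1.
have N0 := normsq_ge0 (xhat (st k w) - xstar).
have S0 : 0 <= B * \sum_i normsq (b i w).
  by rewrite mulr_ge0 ?sumr_ge0// => i _; exact: normsq_ge0.
have h3 := ler_wpM2r N0 rho_step.
have h4 := ler_wpM2r S0 rho_alpha.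
have e5 : 2 * (1 + eta) * beta * gamma * mu * L / (mu + L)
  = kappa * (2 * gamma * mu * L / (mu + L)) by rewrite /kappa; ring.
rewrite e5 in h3; rewrite /rest -/D in h2 *.
rewrite /kappa in h2 h3 *; move: h2 h3 h4.
move: (2 * gamma * mu * L / (mu + L)) (normsq _) (normsq (_ - _)) => r1 r2 r3.
lra.
Qed.

Let Pot_measurable p : measurable_fun setT (Pot p : Omega -> R).
Proof.
have [mx mxw mh mhw me] := st_measurable k.
have my i : measurable_fun setT (y i : Omega -> B_E).
  exact: delta_hat_measurable.
have mm i : measurable_fun setT (m i : Omega -> B_E).
  by apply: measurable_rVB => //; exact: (measurableT_comp (mgrad i) (mxw i)).
have mb i : measurable_fun setT (b i : Omega -> B_E).
  by apply: measurable_rVB => //; exact: measurable_cst.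
apply: measurable_funD; first apply: measurable_funD.
- apply: measurable_scaled_normsq; apply: measurable_rVB.
    apply: measurable_rVB; first by apply: measurable_rVB => //; exact: measurable_cst.
    by apply: measurable_rVZ; apply: measurable_rVB => //; exact: measurable_cst.
  apply: measurable_rVZ; apply: measurable_rV_sum => i.
  by case: (i < p)%N.
- apply: measurable_sum => i; rewrite /cost; case: (i < p)%N.
    apply: measurable_scaled_normsq; apply: measurable_rVD => //.
    exact: measurable_rVZ.
  apply: measurable_funD => //; apply: measurable_funM => //; apply: measurable_funD.
    exact: measurable_scaled_normsq.
  apply: measurable_funM => //; apply: measurable_funD => //.
  by apply: measurable_normsq; exact: measurable_rVD.
- apply: measurable_funD; apply: measurable_scaled_normsq => //.
  by apply: measurable_rVB => //; exact: measurable_cst.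
Qed.

Lemma expected_lyapunov_step :
  ('E_P[fun w => (beta * (1 - (Cqm + 1) * beta) * normsq (q k w)
     + (normsq (xhat (st k.+1 w) - xstar)
        + B * \sum_i normsq (h_w (st k.+1 w) i - grad (f i) xstar)))%R]
   <= 'E_P[fun w => (beta * (eta ^+ 2 + eta) * normsq (err (st k w))
     + (rho * (normsq (xhat (st k w) - xstar)
          + B * \sum_i normsq (h_w (st k w) i - grad (f i) xstar))
        + (1 + eta) * (1 + n%:R * c * alpha) / n%:R * beta * gamma ^+ 2
          * (n%:R^-1 * \sum_i sigma i ^+ 2)))%R])%E.
Proof.
have [mx mxw mh mhw me] := st_measurable k.
have my i : measurable_fun setT (y i : Omega -> B_E).
  exact: delta_hat_measurable.
have mb i : measurable_fun setT (b i : Omega -> B_E).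
  by apply: measurable_rVB => //; exact: measurable_cst.
have mxs : measurable_fun setT ((fun w => xhat (st k w) - xstar) : Omega -> B_E).
  by apply: measurable_rVB => //; exact: measurable_cst.
have Pot_ge0 p w : 0 <= Pot p w.
  apply: addr_ge0 => //; apply: addr_ge0.
    by apply: mulr_ge0 => //; exact: normsq_ge0.
  by apply: sumr_ge0 => i _; exact: cost_ge0.
apply: (le_trans master_step); apply: (@le_trans _ _ ('E_P[Pot n])%E).
  apply: expectation_ge0_le => [| |w|w].
  - apply: measurable_funD; first apply: measurable_funD.
    + exact: measurable_scaled_normsq.
    + by apply: measurable_scaled_normsq; exact: measurable_rVD.
    + apply: measurable_funM => //; apply: measurable_sum => i.
      by apply: measurable_normsq; apply: measurable_rVD => //; exact: measurable_rVZ.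
  - exact: Pot_measurable.
  - apply: addr_ge0; last first.
      by apply: mulr_ge0 => //; apply: sumr_ge0 => i _; exact: normsq_ge0.
    apply: addr_ge0; apply: mulr_ge0; rewrite ?normsq_ge0 ?subr_ge0//; exact: ltW.
  - exact: master_le_potential.
apply: (le_trans potential_le); apply: expectation_ge0_le => [| |w|w].
- exact: Pot_measurable.
- apply: measurable_funD; first exact: measurable_scaled_normsq.
  apply: measurable_funD => //; apply: measurable_funM => //.
  apply: measurable_funD; first exact: measurable_normsq.
  apply: measurable_funM => //; apply: measurable_sum => i.
  exact: (measurable_normsq (mb i)).
- exact: Pot_ge0.
- by rewrite addrA; exact: potential0_le.
Qed.

End Iteration.

(** * Unrolling the recursion *)

Let sigma2 := n%:R^-1 * \sum_i sigma i ^+ 2.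
Let noise := (1 + eta) * (1 + n%:R * c * alpha) / n%:R * beta * gamma ^+ 2 * sigma2.
Let V := lyapunov P Cqm beta gamma eta c f xstar st q.

(** Additivity for nonnegative functions merges the expectations even when they are infinite. Note
    the shift: q at k goes with the state at k + 1. *)
Let V_expectation k : V k.+1 = ('E_P[fun w =>
  (beta * (1 - (Cqm + 1) * beta) * normsq (q k w)
   + (normsq (xhat (st k.+1 w) - xstar)
   + B * \sum_i normsq (h_w (st k.+1 w) i - grad (f i) xstar)))%R])%E.
Proof.
have [mx mxw mh mhw me] := st_measurable k.+1.
have mxs : measurable_fun setT ((fun w => xhat (st k.+1 w) - xstar) : Omega -> B_E).
  by apply: measurable_rVB => //; exact: measurable_cst.
have mhs i : measurable_fun setT
    ((fun w => h_w (st k.+1 w) i - grad (f i) xstar) : Omega -> B_E).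
  by apply: measurable_rVB => //; exact: measurable_cst.
have msum : measurable_fun setT
    (fun w => \sum_i normsq (h_w (st k.+1 w) i - grad (f i) xstar)).
  by apply: measurable_sum => i; exact: (measurable_normsq (mhs i)).
have sum0 w : 0 <= \sum_i normsq (h_w (st k.+1 w) i - grad (f i) xstar).
  by rewrite sumr_ge0// => i _; exact: normsq_ge0.
have A0 : 0 <= beta * (1 - (Cqm + 1) * beta) by rewrite mulr_ge0// ltW.
rewrite expectation_ge0D; last 4 first.
- exact: measurable_scaled_normsq.
- by apply: measurable_funD; [exact: measurable_normsq|exact: measurable_funM].
- by move=> w; rewrite mulr_ge0 ?normsq_ge0.
- by move=> w; apply: addr_ge0; [exact: normsq_ge0|exact: mulr_ge0].
rewrite expectation_ge0D; last 4 first.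
- exact: measurable_normsq.
- exact: measurable_funM.
- by move=> w; exact: normsq_ge0.
- by move=> w; exact: mulr_ge0.
rewrite expectation_ge0Z//; last 2 first.
- exact: measurable_normsq.
- by move=> w; exact: normsq_ge0.
rewrite expectation_ge0Z// expectation_ge0_sum; last 2 first.
- by move=> i; exact: (measurable_normsq (mhs i)).
- by move=> i w; exact: normsq_ge0.
by rewrite addeA.
Qed.

Let V_ge0 k : (0 <= V k.+1)%E.
Proof.
rewrite V_expectation; apply: expectation_ge0 => w.
apply: addr_ge0; first by rewrite !mulr_ge0 ?normsq_ge0// ltW.
apply: addr_ge0; first exact: normsq_ge0.
by apply: mulr_ge0 => //; apply: sumr_ge0 => i _; exact: normsq_ge0.
Qed.

(** The error in the state at k + 1 is that of compressing q at k, so its mean square is at most Cqm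
    E|q|^2; [rho_master] charges it to the q term of V(k+1). *)
Let V_step k : (V k.+2 <= rho%:E * V k.+1 + noise%:E)%E.
Proof.
have [mx mxw mh mhw me] := st_measurable k.+1.
have mxs : measurable_fun setT ((fun w => xhat (st k.+1 w) - xstar) : Omega -> B_E).
  by apply: measurable_rVB => //; exact: measurable_cst.
have mhs i : measurable_fun setT
    ((fun w => h_w (st k.+1 w) i - grad (f i) xstar) : Omega -> B_E).
  by apply: measurable_rVB => //; exact: measurable_cst.
have noise0 : 0 <= noise.
  rewrite /noise /sigma2 !mulr_ge0 ?invr_ge0 ?sqr_ge0 ?addr_ge0 ?mulr_ge0//;
    try exact: ltW.
  by rewrite sumr_ge0// => i _; exact: sqr_ge0.
have A0 : 0 <= beta * (1 - (Cqm + 1) * beta) by rewrite mulr_ge0// ltW.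
pose Y w := rho * (normsq (xhat (st k.+1 w) - xstar)
  + B * \sum_i normsq (h_w (st k.+1 w) i - grad (f i) xstar)) + noise.
have mY : measurable_fun setT Y.
  apply: measurable_funD => //; apply: measurable_funM => //.
  apply: measurable_funD; first exact: measurable_normsq.
  apply: measurable_funM => //; apply: measurable_sum => i.
  exact: (measurable_normsq (mhs i)).
have Z0 w : 0 <= normsq (xhat (st k.+1 w) - xstar)
    + B * \sum_i normsq (h_w (st k.+1 w) i - grad (f i) xstar).
  by apply: addr_ge0; [exact: normsq_ge0|apply: mulr_ge0 => //;
    apply: sumr_ge0 => i _; exact: normsq_ge0].
have Y0 w : 0 <= Y w by rewrite addr_ge0// mulr_ge0.
have c0 : 0 <= beta * (eta ^+ 2 + eta) by rewrite mulr_ge0 ?addr_ge0 ?sqr_ge0// ltW.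
have nq0 w : 0 <= normsq (q k w) by exact: normsq_ge0.
have mnq : measurable_fun setT (fun w => normsq (q k w)) by exact: measurable_normsq.
have err_le : ('E_P[fun w => normsq (err (st k.+1 w))]
    <= 'E_P[fun w => (Cqm * normsq (q k w))%R])%E.
  have lawZm : has_law P (zm k) lm by case: seeds => _ _ hz _; case: (hz k).
  apply: (@integrate_error _ _ _ P J G GT GI Gm indep d _ _ (inr k) (zm k) lm Qm
    (mzm k) lawZm (fun A h => h) (q k) _ Cqm Cqm_ge0 Qm_compr).
  apply: dore_q_measurable => //; first exact: st_others.
    by move=> i; exact: zg_other.
  by move=> i; exact: zw_other.
have {}err_le : ((beta * (eta ^+ 2 + eta))%:E * 'E_P[fun w => normsq (err (st k.+1 w))]
    <= (rho * (beta * (1 - (Cqm + 1) * beta)))%:E * 'E_P[fun w => normsq (q k w)])%E.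
  apply: (le_trans (lee_wpmul2l _ err_le)); first by rewrite lee_fin.
  rewrite expectation_ge0Z// muleA -EFinM; apply: lee_wpmul2r.
    exact: expectation_ge0.
  by rewrite lee_fin; have := ler_wpM2l (ltW beta_gt0) rho_master; lra.
rewrite V_expectation.
apply: (le_trans (expected_lyapunov_step k.+1)).
rewrite expectation_ge0D//; last 2 first.
- exact: measurable_scaled_normsq.
- by move=> w; rewrite mulr_ge0 ?normsq_ge0.
rewrite expectation_ge0Z//; last 2 first.
- exact: measurable_normsq.
- by move=> w; exact: normsq_ge0.
apply: (le_trans (leeD2r _ err_le)).
rewrite -expectation_ge0Z ?mulr_ge0 ?(ltW beta_gt0)// -expectation_ge0D//; last 2 first.
- exact: measurable_funM.
- by move=> w; rewrite mulr_ge0// mulr_ge0.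
rewrite V_expectation -expectation_ge0Z//; last 2 first.
- apply: measurable_funD; first exact: measurable_funM.
  apply: measurable_funD; first exact: measurable_normsq.
  apply: measurable_funM => //; apply: measurable_sum => i.
  exact: (measurable_normsq (mhs i)).
- by move=> w; rewrite addr_ge0// mulr_ge0.
rewrite -(expectation_cst P noise) -expectation_ge0D//; last 2 first.
- apply: measurable_funM => //; apply: measurable_funD; first exact: measurable_funM.
  apply: measurable_funD; first exact: measurable_normsq.
  apply: measurable_funM => //; apply: measurable_sum => i.
  exact: (measurable_normsq (mhs i)).
- by move=> w; rewrite mulr_ge0// addr_ge0// mulr_ge0.
rewrite le_eqVlt; apply/orP; left; apply/eqP; congr expectation.body.
by apply/funext => w; rewrite /= /noise /sigma2; ring.
Qed.

(** The value noise / (1 - rho) is the fixed point of x -> rho x + noise. *)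
Lemma lyapunov_bound (rho_lt1 : rho < 1) k :
  (V k.+1 <= (rho ^+ k)%:E * V 1%N + (noise / (1 - rho))%:E)%E.
Proof.
have r1 : 0 < 1 - rho by rewrite subr_gt0.
have noise0 : 0 <= noise.
  rewrite /noise /sigma2 !mulr_ge0 ?invr_ge0 ?sqr_ge0 ?addr_ge0 ?mulr_ge0//;
    try exact: ltW.
  by rewrite sumr_ge0// => i _; exact: sqr_ge0.
elim: k => [|k IH].
  by rewrite expr0 mul1e leeDl// lee_fin divr_ge0// ltW.
apply: (le_trans (V_step k)).
have r0 : (0 <= rho%:E)%E by rewrite lee_fin.
apply: (le_trans (leeD2r _ (lee_wpmul2l r0 IH))).
(* V(1) may be infinite, so distributivity rests on nonnegativity. *)
rewrite ge0_muleDr; last 2 first.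
- by rewrite mule_ge0 ?V_ge0// lee_fin exprn_ge0.
- by rewrite lee_fin divr_ge0// ltW.
rewrite muleA -EFinM -exprS -addeA -EFinM -EFinD leeD2l// lee_fin.
by rewrite le_eqVlt; apply/orP; left; apply/eqP; field; rewrite gt_eqF.
Qed.


End Recursion.

Unset Implicit Arguments.
Set Strict Implicit.

Theorem theorem1 (R : realType) (d n : nat) (n_gt0 : (0 < n)%N)
  (* the objective *)
  (f : 'I_n -> 'rV[R]_d -> R) (reg : 'rV[R]_d -> R) (mu L : R)
  (f_diff : forall i x, differentiable (f i) x)
  (f_smooth : forall i, L_smooth (f i) L)
  (mu_ge0 : 0 <= mu)
  (f_sconvex : forall i, strongly_convex (f i) mu)
  (reg_closed : closed_function reg)
  (reg_convex : convex_function [set: convex_lmodType 'rV[R]_d] reg)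
  (xstar : 'rV[R]_d)
  (xstar_min : is_minimizer
     (fun x => n%:R^-1 * \sum_(i < n) f i x + reg x) xstar)
  (* the stochastic gradients and the compression operators *)
  (dS dW dM : measure_display) (S : measurableType dS)
  (W : measurableType dW) (M : measurableType dM)
  (nu : nat -> 'I_n -> probability S R)
  (g : nat -> 'I_n -> S -> 'rV[R]_d -> 'rV[R]_d) (sigma : 'I_n -> R)
  (g_sampling : forall k i,
     sampling_assumption (nu k i) (g k i) (f i) (sigma i))
  (lw : probability W R) (Qw : W -> 'rV[R]_d -> 'rV[R]_d) (Cq : R)
  (Cq_ge0 : 0 <= Cq) (Qw_compr : compression_assumption lw Qw Cq)
  (lm : probability M R) (Qm : M -> 'rV[R]_d -> 'rV[R]_d) (Cqm : R)
  (Cqm_ge0 : 0 <= Cqm) (Qm_compr : compression_assumption lm Qm Cqm)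
  (* the probability space and the independent draws of the run *)
  (dO : measure_display) (Omega : measurableType dO)
  (P : probability Omega R)
  (zg : nat -> 'I_n -> Omega -> S) (zw : nat -> 'I_n -> Omega -> W)
  (zm : nat -> Omega -> M)
  (seeds : fresh_seeds P zg zw zm nu lw lm)
  (* the parameters *)
  (alpha beta gamma eta c : R)
  (c_ge : 4 * Cq * (Cq + 1) / n%:R <= c)
  (alpha_gt0 : 0 < alpha)
  (alpha_ge : (1 - alpha_root n Cq c) / (2 * (Cq + 1)) <= alpha)
  (alpha_le : alpha <= (1 + alpha_root n Cq c) / (2 * (Cq + 1)))
  (beta_gt0 : 0 < beta) (beta_le : beta <= 1 / (Cqm + 1))
  (eta_ge0 : 0 <= eta)
  (eta_lt : (eta%:E < Order.min (eta_bound_master Cqm beta)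
                                (eta_bound_step alpha c mu L))%E)
  (gamma_gt : eta * (mu + L) / (2 * (1 + eta) * mu * L) < gamma)
  (gamma_le : gamma <= 2 / ((1 + c * alpha) * (mu + L)))
  (* the run *)
  (x0 e0 : 'rV[R]_d) :
  let Gr (w : Omega) := fun k i => g k i (zg k i w) in
  let Qwr (w : Omega) := fun k i => Qw (zw k i w) in
  let Qmr (w : Omega) := fun k => Qm (zm k w) in
  let st k w := dore_run alpha beta gamma eta reg
                  (Gr w) (Qwr w) (Qmr w) x0 e0 k in
  let q k w := dore_q alpha beta gamma eta reg
                 (Gr w) (Qwr w) (Qmr w) x0 e0 k in
  let V := lyapunov P Cqm beta gamma eta c f xstar st q in
  let rho := dore_rho Cqm alpha beta gamma eta mu L in
  let sigma2 := n%:R^-1 * \sum_(i < n) sigma i ^+ 2 in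
  rho < 1 /\
  forall k : nat,
    (V k.+1 <= (rho ^+ k)%:E * V 1%N
       + ((1 + eta) * (1 + n%:R * c * alpha) / (n%:R * (1 - rho))
            * beta * gamma ^+ 2 * sigma2)%:E)%E.
Proof.
move=> Gr Qwr Qmr st q V rho sigma2.
have c0 := c_nonneg n_gt0 Cq_ge0 c_ge.
have [mu0 L0] := mu_L_gt0 n_gt0 Cq_ge0 c_ge alpha_gt0 mu_ge0 eta_ge0 eta_lt.
have rho1 : rho < 1.
  exact: (dore_rho_lt1 n_gt0 Cq_ge0 Cqm_ge0 c_ge alpha_gt0 mu_ge0 beta_gt0
    beta_le eta_ge0 eta_lt gamma_gt).
split=> // k.
have -> : (1 + eta) * (1 + n%:R * c * alpha) / (n%:R * (1 - rho)) * beta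
    * gamma ^+ 2 * sigma2
  = (1 + eta) * (1 + n%:R * c * alpha) / n%:R * beta * gamma ^+ 2 * sigma2
    / (1 - rho).
  by rewrite invfM; ring.
have alpha1 := alpha_le1 n_gt0 Cq_ge0 c_ge alpha_le.
apply: (lyapunov_bound n_gt0 f_smooth f_sconvex reg_closed
  (convex_functionP reg_convex) xstar_min g_sampling Qw_compr Cqm_ge0 Qm_compr
  seeds mu0 L0 c0 alpha_gt0 alpha1
  (alpha_quadratic_le0 n_gt0 Cq_ge0 c_ge alpha_ge alpha_le) beta_gt0
  (master_slack_ge0 Cqm_ge0 beta_le)
  (gamma_gt0 n_gt0 Cq_ge0 c_ge alpha_gt0 mu_ge0 eta_ge0 eta_lt gamma_gt)
  (gamma_mul_le n_gt0 Cq_ge0 c_ge alpha_gt0 mu_ge0 eta_ge0 eta_lt gamma_le)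
  eta_ge0 _ _ _ _ _ _ rho1).
- exact: (dore_rho_ge0 _ _ _ _ _ _ n_gt0 Cq_ge0 c_ge alpha_le).
- exact: (dore_rho_ge_alpha Cqm alpha beta gamma eta mu L).
- exact: (dore_rho_ge_step Cqm alpha beta gamma eta mu L).
- exact: (dore_rho_ge_master gamma n_gt0 Cq_ge0 Cqm_ge0 c_ge alpha_le beta_gt0
    beta_le eta_ge0 eta_lt).
Qed.
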